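(* Let $G$ be a countable group acting by isometries on a geodesic metric space $(X,d)$, let $\overline{X} = X \cup \partial X$ be a bordification of $X$, and let $x\in X$ be a base point. Let $\mu$ be a probability measure on $G$ with finite first moment, and suppose the following are true: 1. $\mathbb{P}$-a.e. sample path $(w_n x)$ converges to some $\xi \in \partial X$, and $\check{\mathbb{P}}$-a.e. sample path $(\check{w}_n x)$ converges to some $\eta \in \partial X$. 2. There exists a $G$-equivariant map $P : \partial X \times \partial X \to \mathcal{P}(\Gamma X)$, which associates to any pair of points of the boundary a set of geodesic lines in $X$, such that the map $D$ on $\partial X \times \partial X$ defined as $$D(\eta, \xi) := \sup_{\gamma \in P(\eta, \xi)} d(x, \gamma)$$ (with $D(\eta,\xi) := \infty$ if $P(\eta,\xi)=\emptyset$) is Borel-measurable and finite $\nu \otimes \check{\nu}$-a.e. Then there exists $A \geq 0$ such that for $\mathbb{P}$-a.e. sample path $(w_n x)$ there exists a geodesic ray $\gamma :[0, \infty) \to X$ such that $$\lim_{n \to \infty} \frac{d(w_n x, \gamma(An))}{n} = 0.$$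
   Context: A geodesic segment (ray, line) in $X$ is an isometric embedding into $X$ of a compact interval (of $[0,\infty)$, of $\mathbb{R}$). $X$ is geodesic if any two points are joined by a geodesic segment. $\Gamma X$ is the set of geodesic lines in $X$, and $\mathcal{P}(\Gamma X)$ is the set of all subsets of $\Gamma X$; $G$ acts on both. $G$-equivariance means $P(g\eta,g\xi)=gP(\eta,\xi)$. For $\gamma\in\Gamma X$, $d(x,\gamma)$ is the distance from $x$ to the image of $\gamma$. No relation between the ends of the lines in $P(\eta,\xi)$ and the points $\eta,\xi$ is required. A bordification $\overline{X}$ of $X$ is a Hausdorff, second-countable topological space (not necessarily compact) such that $X$ is homeomorphic to (and identified with) an open dense subset of $\overline{X}$ and such that the action of $G$ on $X$ extends to an action on $\overline{X}$ by homeomorphisms; $\partial X := \overline{X}\setminus X$. Random walk: $\mathbb{P}=\mu^{\mathbb{N}}$ is the product measure on sequences $(g_1,g_2,\dots)\in G^{\mathbb{N}}$ and $w_n := g_1\cdots g_n$. The reflected measure is $\check\mu(g):=\mu(g^{-1})$, $\check{\mathbb{P}}:=\check\mu^{\mathbb{N}}$, and $\check w_n$ denotes the product of the first $n$ increments under $\check{\mathbb{P}}$. When almost every sample path converges to $\partial X$, the hitting measure is $\nu(E):=\mathbb{P}(\lim_{n} w_nx\in E)$, and $\check\nu$ is the hitting measure on $\partial X$ for $\check\mu$. Finite first moment: $\int_G d(x,gx)\,d\mu(g)<\infty$ for some $x\in X$. *)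

(* Defs.v *)
From HB Require Import structures.
From mathcomp Require Import all_boot all_order all_algebra.
From mathcomp Require Import all_classical all_reals all_analysis.
From mathcomp Require Import measurable_realfun.

Set Implicit Arguments.
Unset Strict Implicit.
Unset Printing Implicit Defensive.

Import Order.TTheory GRing.Theory Num.Theory.
Import numFieldNormedType.Exports.

Local Open Scope classical_set_scope.
Local Open Scope ring_scope.

Section Actions.
Context {G : groupType}.

Definition group_action (T : Type) (a : G -> T -> T) : Prop :=
  (forall t, a 1%g t = t) /\ (forall g h t, a (g * h)%g t = a g (a h t)).

Definition isometric_action {R : realType} (X : metricType R)
    (a : G -> X -> X) : Prop :=
  group_action a /\ (forall g y z, mdist (a g y) (a g z) = mdist y z).

End Actions.

Section Geodesics.
Context {R : realType} {X : metricType R}.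

(* A map from an interval I of the line to X is represented by a total function
   R -> X; only its values on I matter. *)
Definition isometric_embedding_on (I : set R) (c : R -> X) : Prop :=
  forall s t, I s -> I t -> mdist (c s) (c t) = `|s - t|.

Definition geodesic_lines : set (R -> X) :=
  [set c | isometric_embedding_on [set: R] c].

Definition geodesic_ray (c : R -> X) : Prop :=
  isometric_embedding_on [set` `[0, +oo[%R] c.

Definition dist_line (y : X) (c : R -> X) : R :=
  inf [set mdist y (c t) | t in [set: R]].

End Geodesics.

Definition geodesic_space {R : realType} (X : metricType R) : Prop :=
  forall y z : X, exists (a b : R) (c : R -> X),
    [/\ a <= b, isometric_embedding_on [set` `[a, b]%R] c, c a = y & c b = z].

Section Bordification.
Context {R : realType} {X : metricType R} {G : groupType}.

(* X is identified with its image under iota. Every measurableType is pointed,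
   so the bordification is taken pointed; this is no restriction, as X is
   nonempty below. *)
Record is_bordification (aX : G -> X -> X) (Xbar : ptopologicalType)
    (iota : X -> Xbar) (aXbar : G -> Xbar -> Xbar) : Prop := IsBordification {
  bord_hausdorff : hausdorff_space Xbar ;
  bord_second_countable : @second_countable Xbar ;
  bord_inj : injective iota ;
  bord_homeo : forall U : set X,
    open U <-> exists2 V : set Xbar, open V & U = iota @^-1` V ;
  bord_open : open (range iota) ;
  bord_dense : dense (range iota) ;
  bord_action : group_action aXbar ;
  bord_continuous : forall g, continuous (aXbar g) ;
  bord_extends : forall g y, aXbar g (iota y) = iota (aX g y) }.

Definition boundary (Xbar : ptopologicalType) (iota : X -> Xbar) : set Xbar :=
  ~` range iota.

End Bordification.

Definition borel (T : ptopologicalType) : Type := g_sigma_algebraType (@open T).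

HB.instance Definition _ (T : ptopologicalType) :=
  Measurable.copy (borel T) (g_sigma_algebraType (@open T)).

Definition discrete (G : groupType) : Type := G.

Section Discrete.
Variable G : groupType.

HB.instance Definition _ := Group.on (discrete G).
HB.instance Definition _ := isPointed.Build (discrete G) (1%g : G).
HB.instance Definition _ := @isMeasurable.Build default_measure_display
  (discrete G) discrete_measurable discrete_measurable0
  discrete_measurableC discrete_measurableU.

End Discrete.

Section RandomWalk.
Variable G : groupType.

Definition coordinate_sets : set (set (nat -> discrete G)) :=
  [set C | exists i (A : set (discrete G)), C = [set w | A (w i)]].

(* G^N with the product sigma-algebra; the increment g_(i+1) is w i. *)
Definition path_space := g_sigma_algebraType coordinate_sets.

Definition walk (w : nat -> G) (n : nat) : G := (\prod_(i < n) w i)%g.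

Context {R : realType}.

Definition reflected (mu : set (discrete G) -> \bar R) :
    set (discrete G) -> \bar R :=
  fun A => mu [set g : discrete G | A (g^-1)%g].

(* The values on finite-dimensional boxes, a pi-system generating the product
   sigma-algebra, determine P uniquely. *)
Definition is_product_measure (m : set (discrete G) -> \bar R)
    (P : probability path_space R) : Prop :=
  forall (n : nat) (A : nat -> set (discrete G)),
    P [set w : path_space | forall i, (i < n)%N -> A i (w i)] =
    (\prod_(i < n) m (A i))%E.

Definition finite_first_moment {X : metricType R} (aX : G -> X -> X)
    (mu : probability (discrete G) R) : Prop :=
  exists y : X, (\int[mu]_g (mdist y (aX g y))%:E < +oo)%E.

Section Hitting.
Context {X : metricType R} {Xbar : ptopologicalType}.
Variables (aX : G -> X -> X) (iota : X -> Xbar) (x : X).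

Definition converges_to (w : nat -> G) (xi : Xbar) : Prop :=
  iota (aX (walk w n) x) @[n --> \oo] --> xi.

Definition hits (E : set Xbar) : set path_space :=
  [set w | exists xi, [/\ boundary iota xi, E xi & converges_to w xi]].

(* nu E = P (lim w_n x \in E), nu being viewed as a Borel measure on Xbar
   carried by the boundary. The event is only required to be measurable up to a
   P-null set, that is, for the completion of P. *)
Definition is_hitting_measure (P : probability path_space R)
    (nu : probability (borel Xbar) R) : Prop :=
  forall E : set (borel Xbar), measurable E ->
    exists A : set path_space,
      [/\ measurable A, P.-negligible (A `+` hits E) & nu E = P A].

End Hitting.
End RandomWalk.

(* sup of d(x, c) over the lines c of L p, and +oo if there is none. *)
Definition sup_dist {R : realType} {X : metricType R} {Xbar : ptopologicalType}
    (x : X) (L : Xbar -> Xbar -> set (R -> X)) (p : borel Xbar * borel Xbar) :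
    \bar R :=
  if L p.1 p.2 == set0 then +oo%E
  else ereal_sup [set (dist_line x c)%:E | c in L p.1 p.2].

(* Main.v *)
(* Let T be the shift of the bilateral path space, realised as pairs of forward
   and backward paths, and let f be the distance D evaluated at the two limit
   points.  The lines being chosen equivariantly, f o T^n bounds the distance
   from w_n x to every line of P(eta, xi), and f o T <= f + d(x, g_1 x).  Hence
   (f o T^n - M)^+ is at most (f - M)^+ plus the Birkhoff sum of d(x, g_1 x)
   over the visits to {f o T > M}; the maximal inequality makes the latter small
   relative to n, so f o T^n = o(n) without any integrability of f.

   The drift A is the liminf of d(x, w_n x) / n, which is shift invariant and
   hence almost surely constant.  Covering [0, n) greedily by blocks on which
   the displacement is at most A + epsilon times the length bounds d(x, w_n x) by
   (A + epsilon) n plus a Birkhoff sum over a rare event, again controlled by the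
   maximal inequality; so the liminf is a limit.

   Finally let t_n be the time at which a line of P(eta, xi) comes close to
   w_n x.  Then |t_n| = A n + o(n) and t_(n+1) - t_n = o(n), so t_n has eventually
   constant sign, and the corresponding half of the line is the ray. *)

Require Import Defs.
From HB Require Import structures.
From mathcomp Require Import all_boot all_order all_algebra.
From mathcomp Require Import all_classical all_reals all_analysis.
From mathcomp Require Import measurable_realfun.
From mathcomp Require Import lra.

Set Implicit Arguments.
Unset Strict Implicit.
Unset Printing Implicit Defensive.

Import Order.TTheory GRing.Theory Num.Theory.
Import numFieldNormedType.Exports.

Local Open Scope classical_set_scope.
Local Open Scope ring_scope.

(** * The maximal ergodic inequality *)

Section MeasurePreserving.
Context d (T : measurableType d) (R : realType) (P : probability T R).

Definition measure_preserving (S : T -> T) : Prop :=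
  measurable_fun setT S /\
  forall B, measurable B -> P (S @^-1` B) = P B.

Definition birkhoff_sum (S : T -> T) (f : T -> R) (n : nat) (w : T) : R :=
  \sum_(k < n) f (iter k S w).

(** The maximum of [birkhoff_sum S f k w - c * k%:R] over [k <= n], written as the recursion that
    Garsia's argument exploits. *)
Fixpoint garsia (S : T -> T) (f : T -> R) (c : R) (n : nat) (w : T) : R :=
  if n is m.+1 then Num.max 0 (f w - c + garsia S f c m (S w)) else 0.

Variables (S : T -> T) (S_mp : measure_preserving S).

Lemma measurable_iter n : measurable_fun setT (iter n S).
Proof.
elim: n => [|n ih] /=; first exact: measurable_id.
exact: (measurableT_comp (proj1 S_mp)).
Qed.

Lemma measure_preserving_iter n B : measurable B ->
  P (iter n S @^-1` B) = P B.
Proof.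
move=> mB; elim: n => [//|n ih].
transitivity (P (S @^-1` (iter n S @^-1` B))).
  by congr (P _); apply/seteqP; split => w /=; rewrite -iterS iterSr.
rewrite (proj2 S_mp)//.
by rewrite -[X in measurable X]setTI; exact: measurable_iter.
Qed.

Lemma ae_iter (Q : T -> Prop) :
  {ae P, forall w, Q w} -> {ae P, forall w, forall n, Q (iter n S w)}.
Proof.
move=> [N [mN N0 QN]]; apply: ae_foralln => n; exists (iter n S @^-1` N); split.
- by rewrite -[X in measurable X]setTI; exact: measurable_iter.
- by apply: etrans N0; exact: measure_preserving_iter.
- by move=> w /= /QN.
Qed.

Lemma integral_measure_preserving (f : T -> \bar R) :
  measurable_fun setT f -> (forall w, 0 <= f w)%E ->
  (\int[P]_w f (S w) = \int[P]_w f w)%E.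
Proof.
move=> mf f0; have [mS PS] := S_mp.
rewrite -[LHS](@ge0_integral_pushforward _ _ _ _ _ _ mS P setT f)//.
apply: eq_measure_integral => A mA _; exact: PS.
Qed.

Lemma birkhoff_sumS f n w :
  birkhoff_sum S f n.+1 w = f w + birkhoff_sum S f n (S w).
Proof.
rewrite /birkhoff_sum big_ord_recl; congr (_ + _).
by apply: eq_bigr => i _; rewrite -iterSr.
Qed.

Lemma birkhoff_sum_ge0 f n w :
  (forall w, 0 <= f w) -> 0 <= birkhoff_sum S f n w.
Proof. by move=> f0; apply: sumr_ge0 => i _. Qed.

Lemma measurable_birkhoff_sum f n :
  measurable_fun setT f -> measurable_fun setT (birkhoff_sum S f n).
Proof.
move=> mf; apply: measurable_sum => i.
exact: (measurableT_comp mf (measurable_iter i)).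
Qed.

Section maximal.
Variables (f : T -> R) (c : R).
Hypotheses (mf : measurable_fun setT f) (f0 : forall w, 0 <= f w) (c0 : 0 < c).
Hypothesis (intf : (\int[P]_w (f w)%:E < +oo)%E).

Local Notation M := (garsia S f c).

Lemma garsia_ge0 n w : 0 <= M n w.
Proof. by case: n => //= n; rewrite le_max lexx. Qed.

Lemma measurable_garsia n : measurable_fun setT (M n).
Proof.
elim: n => [|n ih]; first exact: measurable_cst.
apply: measurable_maxr; first exact: measurable_cst.
apply: measurable_funD; first exact: measurable_funB.
exact: (measurableT_comp ih (proj1 S_mp)).
Qed.

Lemma garsia_leS n w : M n w <= M n.+1 w.
Proof.
elim: n w => [|n ih] w; first exact: garsia_ge0.
have := ih (S w); rewrite -(lerD2l (f w - c)) => h.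
by rewrite [M n.+1 w]/= ge_max garsia_ge0 /= le_max h orbT.
Qed.

Lemma birkhoff_sum_le_garsia n w : birkhoff_sum S f n w - c * n%:R <= M n w.
Proof.
elim: n w => [|n ih] w; first by rewrite /birkhoff_sum big_ord0 mulr0 subr0.
rewrite birkhoff_sumS /= le_max; apply/orP; right.
have := ih (S w); rewrite -natr1; lra.
Qed.

(** By induction, from [M n.+1 <= f + M n \o S] and the invariance of [P]. Finiteness is what
    permits the cancellation in [maximal_garsia]. *)
Lemma integral_garsia_fin n : (\int[P]_w (M n w)%:E < +oo)%E.
Proof.
elim: n => [|n ih]; first by rewrite /= integral0.
apply: (@le_lt_trans _ _ (\int[P]_w ((f w)%:E + (M n (S w))%:E)))%E.
  apply: ge0_le_integral => //.
  - by move=> w _; rewrite lee_fin garsia_ge0.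
  - exact/measurable_EFinP/measurable_garsia.
  - apply: emeasurable_funD; apply/measurable_EFinP => //.
    exact: (measurableT_comp (measurable_garsia n) (proj1 S_mp)).
  - move=> w _; rewrite -EFinD lee_fin /= ge_max addr_ge0 ?garsia_ge0//=.
    by rewrite lerD2r gerBl ltW.
rewrite ge0_integralD//; last 4 first.
- by move=> w _; rewrite lee_fin.
- exact/measurable_EFinP.
- by move=> w _; rewrite lee_fin garsia_ge0.
- apply/measurable_EFinP.
  exact: (measurableT_comp (measurable_garsia n) (proj1 S_mp)).
rewrite (@integral_measure_preserving (EFin \o M n)); last 2 first.
- exact/measurable_EFinP/measurable_garsia.
- by move=> w; rewrite lee_fin garsia_ge0.
by rewrite lte_add_pinfty.
Qed.

(* On [M_{n+1} > 0] one has [M_{n+1} + c = f + M_n \o S], and elsewhere the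
   right-hand side is nonnegative. *)
Lemma maximal_garsia n :
  (c%:E * P [set w | (0 < M n w)%R] <= \int[P]_w (f w)%:E)%E.
Proof.
case: n => [|n].
  rewrite (_ : [set _ | _] = set0) ?measure0 ?mule0; last first.
    by apply/seteqP; split => w //=; rewrite ltxx.
  by apply: integral_ge0 => w _; rewrite lee_fin.
set E := [set w | _].
have mE : measurable E.
  rewrite -[E]setTI; apply: measurable_fun_ltr => //.
  exact: measurable_garsia.
have mM k : measurable_fun setT (fun w => (M k w)%:E).
  exact/measurable_EFinP/measurable_garsia.
have M0 k w : (0 <= (M k w)%:E)%E by rewrite lee_fin garsia_ge0.
have mMS : measurable_fun setT (fun w => (M n (S w))%:E).
  apply/measurable_EFinP.
  exact: (measurableT_comp (measurable_garsia n) (proj1 S_mp)).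
have : (\int[P]_w ((M n.+1 w)%:E + c%:E * (\1_E w)%:E) <=
        \int[P]_w ((f w)%:E + (M n (S w))%:E))%E.
  apply: ge0_le_integral => //.
  - move=> w _; apply: adde_ge0 => //.
    by rewrite mule_ge0// ?lee_fin ?ltW.
  - apply: emeasurable_funD; [exact: mM|apply: measurable_funeM].
    exact/measurable_EFinP/measurable_indic.
  - by apply: emeasurable_funD => //; exact/measurable_EFinP.
  - move=> w _; rewrite -EFinM -!EFinD lee_fin indicE.
    have [wE|wE] := boolP (w \in E).
      move: wE; rewrite inE /E /= lt_max ltxx /= => h.
      rewrite (max_r (ltW h)) mulr1; lra.
    rewrite mulr0 addr0.
    suff -> : M n.+1 w = 0 by rewrite addr_ge0 ?garsia_ge0.
    apply/eqP; rewrite eq_le garsia_ge0 andbT leNgt; apply/negP => h.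
    by move/negP: wE; apply; rewrite inE.
rewrite ge0_integralD//; last 2 first.
- by move=> w _; rewrite mule_ge0// ?lee_fin ?ltW.
- apply: measurable_funeM.
  exact/measurable_EFinP/measurable_indic.
rewrite ge0_integralD//; last 2 first.
- by move=> w _; rewrite lee_fin.
- exact/measurable_EFinP.
rewrite (@integral_measure_preserving (fun w => (M n w)%:E)); last 2 first.
- exact: mM.
- by move=> w.
rewrite ge0_integralZl//; last 2 first.
- exact/measurable_EFinP/measurable_indic.
- by rewrite lee_fin ltW.
rewrite integral_indic// setIT => h.
(* Invariance has removed the shift on the right; monotonicity in [n] now bounds that integral by
   the one of [M n.+1], which cancels. *)
have le2 : (\int[P]_w (M n w)%:E <= \int[P]_w (M n.+1 w)%:E)%E.
  by apply: ge0_le_integral => // w _; rewrite lee_fin garsia_leS.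
have fin k : (\int[P]_w (M k w)%:E)%E \is a fin_num.
  rewrite ge0_fin_numE ?integral_garsia_fin//.
  by apply: integral_ge0 => w _; rewrite M0.
rewrite -(@leeD2lE _ _ _ _ (fin n.+1)); apply: (le_trans h).
by rewrite addeC leeD2r.
Qed.

Lemma measurable_maximal_set :
  measurable [set w | exists n, c * n%:R < birkhoff_sum S f n w].
Proof.
rewrite (_ : [set _ | _] =
    \bigcup_n [set w | c * n%:R < birkhoff_sum S f n w]); last first.
  by apply/seteqP; split => w /= [n] h; exists n.
apply: bigcupT_measurable => n; rewrite -[X in measurable X]setTI.
by apply: measurable_fun_ltr => //; exact: measurable_birkhoff_sum.
Qed.

(** The sets [0 < M n] increase with [n] and their union contains the event, so the bound of
    [maximal_garsia] passes to the limit. *)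
Lemma maximal_ergodic :
  (c%:E * P [set w | exists n, (c * n%:R < birkhoff_sum S f n w)%R] <=
    \int[P]_w (f w)%:E)%E.
Proof.
pose E n := [set w | 0 < M n w].
have mE n : measurable (E n).
  rewrite -[E n]setTI; apply: measurable_fun_ltr => //.
  exact: measurable_garsia.
have ndE : nondecreasing_seq E.
  apply/nondecreasing_seqP => n; apply/subsetPset => w /= h.
  exact: lt_le_trans h (garsia_leS n w).
have mU : measurable (\bigcup_n E n) by exact: bigcupT_measurable.
apply: (@le_trans _ _ (c%:E * P (\bigcup_n E n))%E).
  apply: lee_wpmul2l; first by rewrite lee_fin ltW.
  apply: le_measure; rewrite ?inE//; first exact: measurable_maximal_set.
  move=> w [n h]; exists n => //=; apply: lt_le_trans (birkhoff_sum_le_garsia n w).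
  by rewrite subr_gt0.
have cv := nondecreasing_cvg_mu mE mU ndE.
have cv2 : (c%:E * P (E n))%E @[n --> \oo] --> (c%:E * P (\bigcup_n E n))%E.
  by apply: cvgeZl => //; exact: cv.
rewrite -(cvg_lim _ cv2)//; apply: lime_le.
  by apply/cvg_ex; eexists; exact: cv2.
by apply: nearW => n; exact: maximal_garsia.
Qed.

End maximal.
End MeasurePreserving.

(** * Sublinear growth along orbits *)

Section Sublinear.
Context {R : realType}.

(** A one-sided condition: the limsup of [u n / n] is at most 0. The constant [K] absorbs the
    finitely many early terms. *)
Definition sublinear (u : nat -> R) : Prop :=
  forall e : R, 0 < e -> exists K, forall n, u n <= K + e * n%:R.

Lemma invr_nat_le (e : R) : 0 < e -> exists j : nat, j.+1%:R^-1 <= e.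
Proof.
move=> e0; exists (Num.bound e^-1).
rewrite -[leRHS]invrK lef_pV2 ?posrE ?invr_gt0//.
apply: (@le_trans _ _ (Num.bound e^-1)%:R); last by rewrite ler_nat.
by apply/ltW/archi_boundP; rewrite invr_ge0 ltW.
Qed.

(** Countably many tolerances suffice, so almost sure bounds, one for each [j], can be
    intersected. *)
Lemma sublinearP (u : nat -> R) :
  (forall j : nat, exists K, forall n, u n <= K + j.+1%:R^-1 * n%:R) ->
  sublinear u.
Proof.
move=> H e /invr_nat_le[j hj].
have [K HK] := H j; exists K => n; apply: (le_trans (HK n)).
by rewrite lerD2l ler_wpM2r.
Qed.

Lemma sublinear_le (u v : nat -> R) :
  (forall n, u n <= v n) -> sublinear v -> sublinear u.
Proof.
move=> uv sv e e0; have [K HK] := sv e e0.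
by exists K => n; exact: le_trans (uv n) (HK n).
Qed.

Lemma sublinearD (u v : nat -> R) :
  sublinear u -> sublinear v -> sublinear (fun n => u n + v n).
Proof.
move=> su sv e e0; have e20 : 0 < e / 2 by rewrite divr_gt0.
have [K HK] := su _ e20; have [L HL] := sv _ e20.
exists (K + L) => n; have := HK n; have := HL n; lra.
Qed.

Lemma sublinear_norm (u : nat -> R) :
  sublinear u -> sublinear (fun n => - u n) -> sublinear (fun n => `|u n|).
Proof.
move=> su sNu e e0; have [K HK] := su e e0; have [L HL] := sNu e e0.
exists (Num.max K L) => n; rewrite ler_norml; apply/andP; split.
  have : L <= Num.max K L by rewrite le_max lexx orbT.
  have := HL n; lra.
have : K <= Num.max K L by rewrite le_max lexx.
have := HK n; lra.
Qed.

Lemma sublinear_cst (a : R) : sublinear (fun=> a).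
Proof.
by move=> e e0; exists a => n; rewrite lerDl mulr_ge0// ltW.
Qed.

Lemma sublinear_shift (u : nat -> R) :
  sublinear u -> sublinear (fun n => u n.+1).
Proof.
move=> su e e0; have [K HK] := su e e0; exists (K + e) => n.
have := HK n.+1; rewrite -natr1; lra.
Qed.

Lemma sublinear_near (u : nat -> R) (e : R) : sublinear u -> 0 < e ->
  \forall n \near \oo, u n <= e * n%:R.
Proof.
move=> su e0; have e20 : 0 < e / 2 by rewrite divr_gt0.
have [K HK] := su _ e20.
near=> n; apply: (le_trans (HK n)).
suff : K <= e / 2 * n%:R by lra.
rewrite mulrC -ler_pdivrMr//; near: n; exact: nbhs_infty_ger.
Unshelve. all: by end_near. Qed.

Lemma sublinear_cvg (u v : nat -> R) : (forall n, 0 <= u n) ->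
  (\forall n \near \oo, u n <= v n) -> sublinear v ->
  u n / n%:R @[n --> \oo] --> (0 : R).
Proof.
move=> u0 uv sv; apply/cvgr0Pnorm_le => e e0.
near=> n.
have n0 : 0 < n%:R :> R by rewrite ltr0n; near: n; exact: nbhs_infty_gt.
rewrite ger0_norm ?divr_ge0// ler_pdivrMr//.
apply: (@le_trans _ _ (v n)); first by near: n.
by near: n; exact: sublinear_near.
Unshelve. all: by end_near. Qed.

End Sublinear.

(** * Small Birkhoff sums and one-step growth bounds *)

Section Ergodic.
Context d (T : measurableType d) (R : realType) (P : probability T R).
Variables (S : T -> T) (S_mp : measure_preserving P S).
Variables (h : T -> R).
Hypotheses (mh : measurable_fun setT h) (h0 : forall w, 0 <= h w).
Hypothesis (inth : (\int[P]_w (h w)%:E < +oo)%E).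

(** The exceptional set lies in every maximal event [E N], whose probability is at most the integral
    of [phi N] divided by [c]; dominated convergence sends this to 0. A single [N] serves all
    [n]. *)
Lemma ae_birkhoff_sum_small (phi : nat -> T -> R) (c : R) :
  (forall N, measurable_fun setT (phi N)) ->
  (forall N w, 0 <= phi N w <= h w) ->
  {ae P, forall w, phi N w @[N --> \oo] --> (0 : R)} ->
  0 < c ->
  {ae P, forall w, exists N, forall n,
    birkhoff_sum S (phi N) n w <= c * n%:R}.
Proof.
move=> mphi phih cphi c0.
have phi0 N w : 0 <= phi N w by have /andP[] := phih N w.
have phile N w : phi N w <= h w by have /andP[] := phih N w.
pose E N := [set w | exists n, c * n%:R < birkhoff_sum S (phi N) n w].
have mE N : measurable (E N) by exact: (measurable_maximal_set S_mp).
exists (\bigcap_N E N); split; first exact: bigcapT_measurable.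
- have leN N : (c%:E * P (\bigcap_N E N) <= \int[P]_w (phi N w)%:E)%E.
    apply: (@le_trans _ _ (c%:E * P (E N))%E).
      apply: lee_wpmul2l; first by rewrite lee_fin ltW.
      apply: le_measure; rewrite ?inE//; first exact: bigcapT_measurable.
      exact: bigcap_inf.
    apply: (maximal_ergodic S_mp (mphi N) (phi0 N) c0).
    apply: le_lt_trans inth; apply: ge0_le_integral => //.
    + by move=> w _; rewrite lee_fin.
    + exact/measurable_EFinP.
    + exact/measurable_EFinP.
    + by move=> w _; rewrite lee_fin.
  have [_ _ cv] : [/\ P.-integrable setT (cst 0%E : T -> \bar R),
      [sequence (\int[P]_w `|(phi n w)%:E - 0|)%E]_n @ \oo --> 0%E &
      [sequence (\int[P]_w (phi n w)%:E)%E]_n @ \oo --> (\int[P]_w 0)%E].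
    apply: (@dominated_convergence _ _ _ _ _ _ _ _ (EFin \o h)) => //.
    + by move=> n; exact/measurable_EFinP.
    + apply: filterS cphi => w cw _; by apply: cvg_EFin => //; exact: nearW.
    + apply/integrableP; split; first exact/measurable_EFinP.
      apply: le_lt_trans inth; apply: ge0_le_integral => //.
      * by apply: measurableT_comp => //; exact/measurable_EFinP.
      * exact/measurable_EFinP.
      * by move=> w _; rewrite /= ger0_norm.
    + by apply: aeW => w n _; rewrite /= lee_fin ger0_norm.
  move: cv; rewrite integral0 => cv.
  have : (c%:E * P (\bigcap_N E N) <= 0)%E.
    rewrite -(cvg_lim _ cv)//; apply: lime_ge.
      by apply/cvg_ex; eexists; exact: cv.
    by apply: nearW => N; exact: leN.
  rewrite pmule_rle0 ?lte_fin// measure_le0.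
  by move/eqP.
- move=> w /= nw N _; apply: contrapT => nE; apply: nw; exists N => n.
  by rewrite leNgt; apply/negP => h'; apply: nE; exists n.
Qed.

(* With [phi_M := h] on [f \o S > M] and [0] elsewhere, induction on [n] gives
   [f (S^n w) <= M + f w + birkhoff_sum phi_M n w]. *)
Lemma ae_sublinear_iter (f : T -> R) :
  measurable_fun setT f -> (forall w, 0 <= f w) ->
  {ae P, forall w, f (S w) <= f w + h w} ->
  {ae P, forall w, sublinear (fun n => f (iter n S w))}.
Proof.
move=> mf f0 fh.
pose phi (M : nat) w := if M%:R < f (S w) then h w else 0.
have mphi M : measurable_fun setT (phi M).
  apply: measurable_fun_ifT => //; apply: measurable_fun_ltr => //.
  exact: (measurableT_comp mf (proj1 S_mp)).
have phih M w : 0 <= phi M w <= h w.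
  by rewrite /phi; case: ifP => _; rewrite h0 lexx.
have cphi w : phi N w @[N --> \oo] --> (0 : R).
  apply: cvg_near_cst; near=> N; rewrite /phi ifF//.
  apply/negbTE; rewrite -leNgt.
  by near: N; exact: nbhs_infty_ger.
have small : {ae P, forall w, forall j : nat, exists N, forall n,
    birkhoff_sum S (phi N) n w <= j.+1%:R^-1 * n%:R}.
  by apply: ae_foralln => j; apply: ae_birkhoff_sum_small => //; exact: aeW.
apply: filterS2 (ae_iter S_mp fh) small => w fhw smallw.
apply: sublinearP => j; have [N HN] := smallw j.
exists (N%:R + f w) => n.
suff le : f (iter n S w) <= N%:R + f w + birkhoff_sum S (phi N) n w.
  by apply: (le_trans le); rewrite lerD2l.
elim: n {HN} => [|n ih].
  by rewrite /birkhoff_sum big_ord0 addr0 lerDr.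
have := fhw n; rewrite -[S (iter n S w)]/(iter n.+1 S w) => le.
rewrite [birkhoff_sum _ _ _ _]big_ord_recr/= -/(birkhoff_sum _ _ _ _).
(* If the new value exceeds [N], the one-step bound adds [h], which [phi] records. Otherwise the
   value is at most [N] and the other terms only have to be nonnegative. *)
rewrite {2}/phi; case: ltP => [_|leN]; first by move: le ih => /=; lra.
have := @birkhoff_sum_ge0 _ _ _ S (phi N) n w.
move=> /(_ (fun w => proj1 (andP (phih N w)))); have := f0 w.
by move: leN => /=; lra.
Unshelve. all: by end_near. Qed.

End Ergodic.

(** * Subadditive processes that reach nonpositive values *)

Section Subadditive.
Context d (T : measurableType d) (R : realType) (P : probability T R).
Variables (S : T -> T) (S_mp : measure_preserving P S).
Variables (h : T -> R).
Hypotheses (mh : measurable_fun setT h) (h0 : forall w, 0 <= h w).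
Hypothesis (inth : (\int[P]_w (h w)%:E < +oo)%E).

(** The trivial inequality [h (S w) <= h w + h (S w)] is a one-step growth bound with increment
    [h \o S], integrable by invariance. *)
Lemma ae_sublinear_orbit :
  {ae P, forall w, sublinear (fun n => h (iter n S w))}.
Proof.
apply: (@ae_sublinear_iter _ _ _ _ _ S_mp (h \o S)) => //.
- exact: (measurableT_comp mh (proj1 S_mp)).
- by move=> w /=.
- rewrite (integral_measure_preserving S_mp (f := EFin \o h))//.
  exact/measurable_EFinP.
- by apply: aeW => w /=; rewrite lerDr.
Qed.

Variable b : nat -> T -> R.
Hypothesis mb : forall n, measurable_fun setT (b n).
Hypothesis b0 : forall w, b 0%N w <= 0.
Hypothesis b1 : forall w, b 1%N w <= h w.
Hypothesis bD : forall l n w, b (l + n)%N w <= b l w + b n (iter l S w).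

(** The cost, in the greedy covering, of a point at which no block of length at most [N] with
    nonpositive [b] starts. *)
Let phi (N : nat) (w : T) := if [forall l : 'I_N, 0 < b l.+1 w] then h w else 0.

Let phi_ge0 N w : 0 <= phi N w.
Proof. by rewrite /phi; case: ifP. Qed.

Let measurable_phi N : measurable_fun setT (phi N).
Proof.
elim: N => [|N ih].
  rewrite (_ : phi _ = h)//; apply/funext => w; rewrite /phi ifT//.
  by apply/forallP => -[].
rewrite (_ : phi _ = fun w => if 0 < b N.+1 w then phi N w else 0); last first.
  apply/funext => w; rewrite /phi; case: (boolP [forall _, _]) => [/forallP H|].
    rewrite (H ord_max) ifT//; apply/forallP => l.
    exact: (H (widen_ord (leqnSn N) l)).
  move=> /forallPn[l Hl]; case: ifP => // bN.
  rewrite ifF//; apply/negbTE/forallPn.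
  have lN : (l < N)%N.
    have := ltn_ord l; rewrite ltnS leq_eqVlt => /orP[/eqP lN|//].
    by move: Hl; rewrite lN bN.
  by exists (Ordinal lN).
by apply: measurable_fun_ifT => //; exact: measurable_fun_ltr.
Qed.

Lemma birkhoff_sumD f l n w :
  birkhoff_sum S f (l + n) w =
  birkhoff_sum S f l w + birkhoff_sum S f n (iter l S w) :> R.
Proof.
rewrite /birkhoff_sum big_split_ord/=; congr (_ + _).
by apply: eq_bigr => i _; rewrite addnC iterD.
Qed.

Let b_le_sum n w : b n w <= birkhoff_sum S h n w.
Proof.
elim: n w => [|n ih] w; first by rewrite /birkhoff_sum big_ord0.
rewrite birkhoff_sumS; apply: (le_trans (bD 1 n w)).
by apply: lerD => //; exact: ih.
Qed.

(* Cut [0, n) greedily into blocks [k, k + l) with [b l (S^k w) <= 0] and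
   single bad times, on which [b] costs [h]; the last N times stay uncut. *)
Let covering N n w : exists q r, [/\ (q + r)%N = n, (r <= N)%N &
  b n w <= birkhoff_sum S (phi N) n w + birkhoff_sum S h r (iter q S w)].
Proof.
have [m] := ubnP n; elim: m n w => // m ih n w; rewrite ltnS => nm.
have [nN|Nn] := leqP n N.
  exists 0%N, n; split => //; apply: (le_trans (b_le_sum n w)).
  by rewrite lerDr birkhoff_sum_ge0.
have [bad|/forallPn[l]] := boolP [forall l : 'I_N, 0 < b l.+1 w].
  case: n => // n in nm Nn *.
  have [q [r [qr rN le]]] := ih n (S w) nm.
  exists q.+1, r; split => //; first by rewrite -qr.
  rewrite birkhoff_sumS {1}/phi bad iterSr -addrA.
  apply: (le_trans (bD 1 n w)); exact: lerD.
rewrite -leNgt => bl.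
(* More than [N] times remain, so a block of length at most [N] fits. *)
have ln : (l < n)%N by apply: ltn_trans Nn.
have nE : (l.+1 + (n - l.+1))%N = n by rewrite subnKC.
have [|q [r [qr rN le]]] := ih (n - l.+1)%N (iter l.+1 S w).
  by apply: leq_trans nm; rewrite ltn_subrL/= (leq_ltn_trans _ ln).
exists (q + l.+1)%N, r; split => //; first by rewrite addnAC qr subnK.
rewrite -[X in b X]nE; apply: (le_trans (bD _ _ _)).
rewrite -[X in birkhoff_sum _ _ X _ + _]nE birkhoff_sumD iterD.
rewrite -addrA; apply: lerD => //.
by apply: (le_trans bl); exact: birkhoff_sum_ge0.
Qed.

(** By [covering], [b n] is at most a Birkhoff sum of [phi N], small by the maximal inequality, plus
    at most [N] values of [h] along the orbit, each sublinear by [ae_sublinear_orbit]. *)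
Lemma ae_sublinear_subadditive :
  {ae P, forall w, exists l, b l.+1 w <= 0} ->
  {ae P, forall w, sublinear (b ^~ w)}.
Proof.
move=> ex.
have cphi : {ae P, forall w, phi N w @[N --> \oo] --> (0 : R)}.
  apply: filterS ex => w [l bl]; apply: cvg_near_cst; near=> N.
  rewrite /phi ifF//; apply/negbTE/forallPn.
  have lN : (l < N)%N by near: N; exact: nbhs_infty_gt.
  by exists (Ordinal lN); rewrite -leNgt.
have small : {ae P, forall w, forall j : nat, exists N, forall n,
    birkhoff_sum S (phi N) n w <= (j.+1%:R^-1 / 2) * n%:R}.
  apply: ae_foralln => j; apply: (ae_birkhoff_sum_small S_mp mh) => //.
  by move=> N w; rewrite phi_ge0 /phi/=; case: ifP => _; rewrite ?lexx ?h0.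
apply: filterS2 ae_sublinear_orbit small => w subh smallw.
apply: sublinearP => j; have [N HN] := smallw j.
(* At most [N] uncut times, each with error [e * n%:R], together use up at most half of the
   tolerance; [N.+1] avoids a zero divisor. *)
pose e : R := j.+1%:R^-1 / 2 / N.+1%:R.
have e0 : 0 < e by rewrite !divr_gt0.
have [K HK] := subh e e0.
exists (N%:R * `|K|) => n.
have [q [r [qr rN le]]] := covering N n w; apply: (le_trans le).
(* Taking the absolute value of [K] makes the summands nonnegative, so that their number [r] can be
   replaced by [N]. *)
have : birkhoff_sum S h r (iter q S w) <= N%:R * (`|K| + e * n%:R).
  apply: (@le_trans _ _ (\sum_(k < r) (`|K| + e * n%:R))).
    apply: ler_sum => k _; rewrite -iterD; apply: (le_trans (HK _)).
    apply: lerD; first exact: ler_norm.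
    rewrite ler_wpM2l ?(ltW e0)// ler_nat -qr addnC leq_add2l.
    exact: ltnW.
  rewrite sumr_const card_ord -[leLHS]mulr_natl ler_wpM2r ?ler_nat//.
  by rewrite addr_ge0// mulr_ge0// ltW.
have : N%:R * (e * n%:R) <= j.+1%:R^-1 / 2 * n%:R.
  rewrite mulrA ler_wpM2r// /e mulrCA -[leRHS]mulr1 ler_wpM2l ?divr_ge0//.
  by rewrite ler_pdivrMr// mul1r ler_nat.
have := HN n; rewrite mulrDr.
by move: (N%:R * (e * _)) (N%:R * `|K|) (j.+1%:R^-1) => a k c; lra.
Unshelve. all: by end_near. Qed.

End Subadditive.

(** * The shift on the path space *)

Section PathSpace.
Variable G : groupType.

Local Notation path := (path_space G).

Definition box (n : nat) (A : nat -> set (discrete G)) : set path :=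
  [set w | forall i, (i < n)%N -> A i (w i)].

Definition path_shift (w : path) : path := fun i => w i.+1.

Definition path_cons (g : G) (w : path) : path :=
  fun i => if i is j.+1 then w j else g.

Lemma measurable_coordinate (i : nat) :
  measurable_fun setT (fun w : path => (w i : discrete G)).
Proof.
move=> _ A _; rewrite setTI; apply: sub_sigma_algebra.
by exists i, A.
Qed.

Lemma measurable_path d (T : measurableType d) (f : T -> path) :
  (forall i, measurable_fun setT (fun t => (f t i : discrete G))) ->
  measurable_fun setT f.
Proof.
move=> mf; apply: (@measurability _ _ T path setT f (@coordinate_sets G) erefl).
move=> _ [_ [i [A ->]] <-]; exact: (mf i).
Qed.

Lemma measurable_discrete d (T : measurableType d) (f : discrete G -> T) :
  measurable_fun setT f.
Proof. by []. Qed.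

Lemma measurable_path_shift : measurable_fun setT path_shift.
Proof. by apply: measurable_path => i; exact: measurable_coordinate. Qed.

Lemma iter_path_shift n (w : path) i : iter n path_shift w i = w (n + i)%N.
Proof. by elim: n i => [//|n ih] i; rewrite iterS /path_shift ih addnS. Qed.

Lemma measurable_box n A : measurable (box n A).
Proof.
rewrite (_ : box n A = \bigcap_(i in [set i | (i < n)%N])
    ((fun w : path => (w i : discrete G)) @^-1` A i)); last first.
  by apply/seteqP; split => w /=.
apply: bigcap_measurableType => i _.
by rewrite -[X in measurable X]setTI; exact: measurable_coordinate.
Qed.

Lemma box_pad n m A : (n <= m)%N ->
  box n A = box m (fun i => if (i < n)%N then A i else setT).
Proof.
move=> nm; apply/seteqP; split => w /= H i im.
  by case: ifP => // iln; exact: H.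
by have := H i (leq_trans im nm); rewrite im.
Qed.

Lemma measurable_box_generated :
  @measurable _ path = <<s [set B | exists n A, B = box n A] >>.
Proof.
apply/seteqP; split.
  apply: smallest_sub; first exact: smallest_sigma_algebra.
  move=> _ [i [A ->]]; apply: sub_sigma_algebra.
  exists i.+1, (fun j => if j == i then A else setT).
  apply/seteqP; split=> w /=.
    by move=> Aw j _; case: eqVneq => // ->.
  by move=> /(_ i (ltnSn i)); rewrite eqxx.
apply: smallest_sub; first exact: sigma_algebra_measurable.
by move=> _ [n [A ->]]; exact: measurable_box.
Qed.

Context {R : realType}.

(** Boxes padded to a common length are stable under intersection, and the box of length 0 is the
    whole space. *)
Lemma box_measure_unique (m1 m2 : {measure set path -> \bar R}) :
  (m1 setT < +oo)%E -> (forall n A, m1 (box n A) = m2 (box n A)) ->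
  forall B, measurable B -> m1 B = m2 B.
Proof.
move=> m1oo m12; apply: (measure_unique _ (fun=> setT) measurable_box_generated).
- move=> _ _ [n [A ->]] [m [B ->]]; rewrite (box_pad A (leq_maxl n m)).
  rewrite (box_pad B (leq_maxr n m)).
  exists (maxn n m), (fun i => (if (i < n)%N then A i else setT) `&`
                                (if (i < m)%N then B i else setT)).
  apply/seteqP; split => w /=.
    by move=> [HA HB] i im; split; [exact: HA|exact: HB].
  by move=> H; split => i /H[].
- move=> _; exists 0%N, (fun=> setT); apply/seteqP; split => //.
- by apply/seteqP; split => // w _; exists 0%N.
- by move=> _ [n [A ->]].
- by [].
Qed.

(** The factor [c] is there for measures restricted to an event: with [c] the probability of that
    event, the conclusion expresses independence. *)
Lemma pushforward_path_unique d (T : measurableType d)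
    (m : {measure set T -> \bar R}) (P : {measure set path -> \bar R})
    (f : T -> path) (c : R) :
  measurable_fun setT f -> (m setT < +oo)%E -> 0 <= c ->
  (forall n A, m (f @^-1` box n A) = (c%:E * P (box n A))%E) ->
  forall B, measurable B -> m (f @^-1` B) = (c%:E * P B)%E.
Proof.
move=> mf moo c0 H B mB; pose c' : {nonneg R} := NngNum c0.
by apply: (@box_measure_unique (pushforward m f) (mscale c' P)).
Qed.

Variables (m : set (discrete G) -> \bar R) (P : probability path R).
Hypothesis Pm : is_product_measure m P.

Lemma product_measure_full : m setT = 1%E.
Proof.
have := Pm 1 (fun=> setT); rewrite big_ord1 => <-.
by rewrite -(probability_setT P); congr (P _); apply/seteqP; split.
Qed.

Lemma product_measure_marginal A : P [set w : path | A (w 0%N)] = m A.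
Proof.
have := Pm 1 (fun=> A); rewrite big_ord1 => <-.
by congr (P _); apply/seteqP; split => w /=; [move=> Aw [|//]|apply].
Qed.

Lemma product_measure_box n A : P (box n A) = (\prod_(i < n) m (A i))%E.
Proof. exact: Pm. Qed.

(** The preimage of a box is a box whose first coordinate is free, and that coordinate contributes
    the factor [m setT], equal to 1. *)
Lemma path_shift_measure_preserving : measure_preserving P path_shift.
Proof.
split; first exact: measurable_path_shift.
move=> B mB; rewrite -[RHS]mul1e.
apply: (@pushforward_path_unique _ _ _ _ path_shift 1) => //.
- exact: measurable_path_shift.
- exact: le_lt_trans (probability_le1 P measurableT) (ltry 1).
move=> n A; rewrite mul1e [RHS]product_measure_box.
rewrite (_ : _ @^-1` _ = box n.+1 (fun i => if i is j.+1 then A j else setT)).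
  by rewrite [LHS]product_measure_box big_ord_recl product_measure_full mul1e.
apply/seteqP; split=> w /=; first by move=> H [//|i]; exact: H.
by move=> H i iln; exact: (H i.+1).
Qed.

(** For a box in place of [E], the two conditions concatenate into one longer box, whose measure
    factorises. Uniqueness for [P] restricted to [box n A] extends this to all events. *)
Lemma box_independent n A E : measurable E ->
  P (box n A `&` (iter n path_shift @^-1` E)) = (P (box n A) * P E)%E.
Proof.
move=> mE; rewrite -(fineK (fin_num_measure P _ (measurable_box n A))).
rewrite setIC; apply: (@pushforward_path_unique _ _
  (mrestr P (measurable_box n A)) P (iter n path_shift)) => //.
- exact: (measurable_iter path_shift_measure_preserving).
- apply: le_lt_trans (probability_le1 P _) (ltry 1).
  by apply: measurableI => //; exact: measurable_box.
- by rewrite fine_ge0.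
move=> k B; rewrite fineK ?fin_num_measure//; last exact: measurable_box.
transitivity (P (iter n path_shift @^-1` box k B `&` box n A)); first by [].
rewrite (_ : _ `&` _ =
    box (n + k) (fun i => if (i < n)%N then A i else B (i - n)%N)).
  rewrite product_measure_box big_split_ord/=; congr (_ * _)%E.
    apply: etrans (esym (product_measure_box _ _)).
    by apply: eq_bigr => i _; rewrite ltn_ord.
  apply: etrans (esym (product_measure_box _ _)).
  by apply: eq_bigr => i _; rewrite ltnNge leq_addr/= addKn.
apply/seteqP; split => w /=.
  move=> [HB HA] i ink; case: ltnP => [iln|nli]; first exact: HA.
  have := HB (i - n)%N; rewrite iter_path_shift subnKC//; apply.
  by rewrite ltn_subLR.
move=> H; split => i.
  move=> ik; rewrite iter_path_shift; have := H (n + i)%N.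
  by rewrite ltn_add2l ik ltnNge leq_addr addKn/=; apply.
by move=> iln; have := H i (ltn_addr _ iln); rewrite iln.
Qed.

(** An invariant event is its own preimage under every iterate, hence independent of every box and
    finally of itself, so [P E] equals its square. *)
Lemma path_shift_zero_one E : measurable E -> path_shift @^-1` E = E ->
  P E = 0%E \/ P E = 1%E.
Proof.
move=> mE invE.
have invn n : iter n path_shift @^-1` E = E.
  elim: n => [//|n ih]; rewrite -[RHS]invE -{2}ih.
  by apply/seteqP; split => w /=; rewrite -iterS iterSr.
have PEfin : P E \is a fin_num by exact: fin_num_measure.
have : P (E `&` E) = (P E * P E)%E.
  rewrite -{1}(fineK PEfin).
  apply: (@pushforward_path_unique _ _ (mrestr P mE) P id (fine (P E))) => //.
  - apply: le_lt_trans (probability_le1 P _) (ltry 1).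
    exact: measurableI.
  - by rewrite fine_ge0.
  move=> n A; rewrite fineK//; transitivity (P (box n A `&` E)); first by [].
  by rewrite -{1}(invn n) box_independent// muleC.
rewrite setIid -(fineK PEfin) -EFinM => -[/eqP].
rewrite -{1}[fine _]mulr1 -subr_eq0 -mulrBr mulf_eq0 => /orP[/eqP ->|].
  by left.
by rewrite subr_eq0 => /eqP <-; right.
Qed.

End PathSpace.

(** * The bilateral shift *)

Section BilateralShift.
Variable G : groupType.
Local Notation path := (path_space G).
Context {R : realType}.

(** The pair encodes a two-sided sequence of increments. The backward path is read leftwards from
    the origin, so the increment that crosses the origin enters it inverted. *)
Definition bishift (u : path * path) : path * path :=
  (path_shift u.1, path_cons ((u.1 : nat -> G) 0%N)^-1%g u.2).

Lemma measurable_bishift : measurable_fun setT bishift.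
Proof.
apply: measurable_fun_pair.
  by apply: measurableT_comp;
    [exact: measurable_path_shift|exact: measurable_fst].
apply: measurable_path => -[|i].
  apply: (measurableT_comp (@measurable_discrete G _ (discrete G)
    (fun g => (g^-1)%g))).
  apply: (measurableT_comp (@measurable_coordinate G 0%N)).
  exact: measurable_fst.
apply: (measurableT_comp (@measurable_coordinate G i)).
exact: measurable_snd.
Qed.

Variables (m : set (discrete G) -> \bar R) (P Pc : probability path R).
Hypotheses (Pm : is_product_measure m P).
Hypothesis (Pcm : is_product_measure (reflected m) Pc).

Local Notation Q := (P \x Pc)%E.

(** The preimage is again a product of boxes: the first backward condition becomes a forward one on
    the inverse, and [reflected] makes the two factors agree. *)
Let bishift_boxS n A k B : Q (bishift @^-1` (box n A `*` box k.+1 B)) =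
  (P (box n A) * Pc (box k.+1 B))%E.
Proof.
rewrite (_ : _ @^-1` _ =
    box n.+1 (fun i => if i is j.+1 then A j else [set g | B 0%N (g^-1)%g]) `*`
    box k (fun i => B i.+1)).
  rewrite product_measure1E; [|exact: measurable_box|exact: measurable_box].
  apply: etrans (congr2 mule (product_measure_box Pm _ _)
                             (product_measure_box Pcm _ _)) _.
  apply: etrans (esym (congr2 mule (product_measure_box Pm _ _)
                                   (product_measure_box Pcm _ _))).
  by rewrite !big_ord_recl muleA [X in (X * _)%E]muleC.
apply/seteqP; split => -[w w'] /=.
  move=> [HA HB]; split; last by move=> i ik; exact: (HB i.+1).
  by move=> [_|i iln]; [exact: (HB 0%N)|exact: HA].
move=> [HA HB]; split; first by move=> i iln; exact: (HA i.+1).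
by move=> [_|i ik]; [exact: (HA 0%N)|exact: HB].
Qed.

Let bishift_box n A k B : Q (bishift @^-1` (box n A `*` box k B)) =
  (P (box n A) * Pc (box k B))%E.
Proof.
case: k => [|k]; last exact: bishift_boxS.
by rewrite (box_pad B (leq0n 1)) bishift_boxS.
Qed.

Let mpre (B : set (path * path)) : measurable B -> measurable (bishift @^-1` B).
Proof.
by move=> mB; rewrite -[X in measurable X]setTI; exact: measurable_bishift.
Qed.

Let Qfin (B : set (path * path)) : measurable B -> (Q B < +oo)%E.
Proof. by move=> mB; exact: le_lt_trans (probability_le1 _ mB) (ltry 1). Qed.

(** Boxes are replaced by arbitrary measurable sets one factor at a time, by uniqueness for [Q]
    restricted to the condition on the other factor. *)
Let bishift_half n A B : measurable B ->
  Q (bishift @^-1` (box n A `*` B)) = (P (box n A) * Pc B)%E.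
Proof.
move=> mB; have mA := measurable_box n A.
have mAT : measurable (bishift @^-1` (box n A `*` setT)).
  by apply: mpre; exact: measurableX.
transitivity
  (Q ((snd \o bishift) @^-1` B `&` (bishift @^-1` (box n A `*` setT)))).
  by congr (Q _); apply/seteqP; split => u /=; tauto.
rewrite -(fineK (fin_num_measure P _ mA)).
apply: (@pushforward_path_unique _ _ _ _ (mrestr Q mAT) Pc) => //.
- by apply: measurableT_comp; [exact: measurable_snd|exact: measurable_bishift].
- by apply: Qfin; exact: measurableI.
- by rewrite fine_ge0.
move=> k C; rewrite fineK ?fin_num_measure//.
apply: etrans (bishift_box n A k C); rewrite /mrestr.
by congr (Q _); apply/seteqP; split => u /=; tauto.
Qed.

Let bishift_rectangle A B : measurable A -> measurable B ->
  Q (bishift @^-1` (A `*` B)) = (P A * Pc B)%E.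
Proof.
move=> mA mB.
have mTB : measurable (bishift @^-1` (setT `*` B)).
  by apply: mpre; exact: measurableX.
transitivity (Q ((fst \o bishift) @^-1` A `&` (bishift @^-1` (setT `*` B)))).
  by congr (Q _); apply/seteqP; split => u /=; tauto.
rewrite muleC -(fineK (fin_num_measure Pc _ mB)).
apply: (@pushforward_path_unique _ _ _ _ (mrestr Q mTB) P) => //.
- by apply: measurableT_comp; [exact: measurable_fst|exact: measurable_bishift].
- by apply: Qfin; exact: measurableI.
- by rewrite fine_ge0.
move=> k C; rewrite fineK ?fin_num_measure// muleC.
apply: etrans (bishift_half k C mB); rewrite /mrestr.
by congr (Q _); apply/seteqP; split => u /=; tauto.
Qed.

Lemma bishift_measure_preserving : measure_preserving Q bishift.
Proof.
split; first exact: measurable_bishift.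
move=> B mB; apply/esym.
apply: (@product_measure_unique _ _ _ _ _ P Pc (pushforward Q bishift)) => //.
exact: measurable_bishift.
Qed.

Lemma iter_bishift1 n u : (iter n bishift u).1 = iter n (@path_shift G) u.1.
Proof. by elim: n => //= n ->. Qed.

End BilateralShift.

(** * The rate of an ergodic subadditive process *)

Section Drift.
Context d (T : measurableType d) (R : realType) (P : probability T R).
Variables (S : T -> T) (S_mp : measure_preserving P S).
Hypothesis S_ergodic : forall E, measurable E -> S @^-1` E = E ->
  P E = 0%E \/ P E = 1%E.
Variables (h : T -> R).
Hypotheses (mh : measurable_fun setT h) (h0 : forall w, 0 <= h w).
Hypothesis (inth : (\int[P]_w (h w)%:E < +oo)%E).
Variable a : nat -> T -> R.
Hypothesis ma : forall n, measurable_fun setT (a n).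
Hypothesis a_ge0 : forall n w, 0 <= a n w.
Hypothesis a0 : forall w, a 0%N w = 0.
Hypothesis a1 : forall w, a 1%N w <= h w.
Hypothesis aD : forall l n w, a (l + n)%N w <= a l w + a n (iter l S w).
Hypothesis aS : forall n w, a n (S w) <= h w + a n.+1 w.

(* The event [liminf a_n / n <= c]. The free constant [k] makes it visibly
   insensitive to bounded perturbations of [a], hence S-invariant. *)
Let low (c : R) : set T :=
  [set w | forall j k : nat, exists n, a n w + k%:R <= (c + j.+1%:R^-1) * n%:R].

Let lowP c w : low c w <->
  (forall e K : R, 0 < e -> exists n, a n w + K <= (c + e) * n%:R).
Proof.
split=> [H e K e0|H j k]; last by apply: H; rewrite invr_gt0.
have [j hj] := invr_nat_le e0.
have [n Hn] := H j (Num.bound `|K|); exists n.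
apply: (@le_trans _ _ (a n w + (Num.bound `|K|)%:R)).
  rewrite lerD2l; apply: (le_trans (ler_norm _)).
  by apply/ltW/archi_boundP.
by apply: (le_trans Hn); rewrite ler_wpM2r// lerD2l.
Qed.

Let measurable_low c : measurable (low c).
Proof.
rewrite (_ : low c = \bigcap_j \bigcap_k \bigcup_n
    [set w | a n w + k%:R <= (c + j.+1%:R^-1) * n%:R]); last first.
  apply/seteqP; split => [w H j _ k _|w H j k].
    by have [n Hn] := H j k; exists n.
  by have [n _ Hn] := H j Logic.I k Logic.I; exists n.
apply: bigcapT_measurable => j; apply: bigcapT_measurable => k.
apply: bigcupT_measurable => n; rewrite -[X in measurable X]setTI.
apply: measurable_fun_ler => //; apply: measurable_funD => //.
Qed.

(** By [aD], [a1] and [aS], the values [a n.+1 w] and [a n (S w)] differ by at most [h w], which the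
    free constant absorbs. *)
Let low_invariant c : 0 <= c -> S @^-1` low c = low c.
Proof.
move=> c0; apply/seteqP; split => w /lowP H; apply/lowP => e K e0.
  have [n Hn] := H e (K + h w) e0; exists n.+1.
  have : a n.+1 w <= h w + a n (S w).
    by have := aD 1 n w; have := a1 w; rewrite add1n /=; lra.
  rewrite -natr1; move: Hn; lra.
(* The positive term [c + e] rules out [n = 0] and pays for lowering the index by one; [h w] pays
   for the shift. *)
have [n] := H e (`|K| + h w + (c + e)) e0.
case: n => [|n Hn].
  rewrite a0 mulr0; have := normr_ge0 K; have := h0 w; lra.
exists n; move: Hn; rewrite -natr1.
by have := aS n w; have := ler_norm K; lra.
Qed.

Let low_mono c c' : c <= c' -> low c `<=` low c'.
Proof.
move=> cc w /lowP H; apply/lowP => e K e0; have [n Hn] := H e K e0.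
by exists n; apply: (le_trans Hn); rewrite ler_wpM2r// lerD2r.
Qed.

(** With [c] above the mean of [h], the maximal event has probability below 1. Off it all Birkhoff
    sums of [h], hence all [a n], are at most [c * n%:R], so [low c] is not null and the zero-one
    hypothesis applies. *)
Let low_ex : exists2 c, 0 <= c & P (low c) = 1%E.
Proof.
pose I := fine (\int[P]_w (h w)%:E); pose c : R := I + 1.
have I0 : (0 <= \int[P]_w (h w)%:E)%E.
  by apply: integral_ge0 => w _; rewrite lee_fin.
have IE : (\int[P]_w (h w)%:E)%E = I%:E by rewrite fineK// ge0_fin_numE.
have I0' : 0 <= I by rewrite fine_ge0.
have c0 : 0 < c by rewrite ltr_wpDl.
pose E := [set w | exists n, c * n%:R < birkhoff_sum S h n w].
have mE : measurable E by exact: (measurable_maximal_set S_mp).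
have PE : (P E < 1)%E.
  have := maximal_ergodic S_mp mh h0 c0 inth; rewrite -/E IE => le.
  rewrite -(@lte_pmul2l _ c%:E)// ?lte_fin// mule1.
  by apply: (le_lt_trans le); rewrite lte_fin /c ltrDl.
exists c; first exact: ltW.
have [|//] := S_ergodic (measurable_low c) (low_invariant (ltW c0)).
move=> Plow.
have : (P (~` E) <= P (low c))%E.
  apply: le_measure; rewrite ?inE//; first exact: measurableC.
  move=> w nE; apply/lowP => e K e0.
  have [n hn] : exists n : nat, K <= e * n%:R.
    exists (Num.bound (`|K| / e)); rewrite mulrC -ler_pdivrMr//.
    apply: (@le_trans _ _ (`|K| / e)).
      by rewrite ler_pM2r ?invr_gt0// ler_norm.
    by apply/ltW/archi_boundP; rewrite divr_ge0// ltW.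
  exists n; rewrite mulrDl; apply: lerD => //.
  rewrite leNgt; apply/negP => lt; apply: nE; exists n.
  apply: (lt_le_trans lt).
  elim: n w {hn lt} => [|n ih] w; first by rewrite a0 /birkhoff_sum big_ord0.
  rewrite birkhoff_sumS; apply: le_trans (lerD (a1 w) (ih (S w))).
  exact: (aD 1 n w).
rewrite Plow probability_setC// leNgt => /negP[].
by rewrite sube_gt0.
Qed.

(** Its infimum is the almost sure value of the liminf of [a n / n]. Negative [c] are left out
    because [low_invariant] assumes [0 <= c]. *)
Let rate : set R := [set c | 0 <= c /\ P (low c) = 1%E].

Let A := inf rate.

Let has_inf_rate : has_inf rate.
Proof.
split; last by exists 0 => c [].
by have [c c0 Pc] := low_ex; exists c.
Qed.

Let A_ge0 : 0 <= A.
Proof. by apply: lb_le_inf; [exact: has_inf_rate.1|move=> c []]. Qed.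

Let ae_low e : 0 < e -> {ae P, forall w, low (A + e) w}.
Proof.
move=> e0; have [c [c0 Pc] cA] := inf_adherent e0 has_inf_rate.
exists (~` low c); split; first exact: measurableC.
  by rewrite probability_setC// Pc subee.
by apply: subsetC; apply: low_mono; exact: ltW.
Qed.

Let ae_not_low c : 0 <= c -> c < A -> {ae P, forall w, ~ low c w}.
Proof.
move=> c0 cA; exists (low c); split => //; last by move=> w /= /contrapT.
have [//|Pc] := S_ergodic (measurable_low c) (low_invariant c0).
exfalso; move: cA; rewrite ltNge => /negP; apply.
by apply: ge_inf; [exact: has_inf_rate.2|].
Qed.

(** Subtracting [(A + e) * n%:R] preserves subadditivity, and [ae_low] with half of [e] supplies a
    time at which the difference is nonpositive. *)
Let ae_upper e : 0 < e ->
  {ae P, forall w, sublinear (fun n => a n w - (A + e) * n%:R)}.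
Proof.
move=> e0.
apply: (@ae_sublinear_subadditive _ _ _ _ _ S_mp h mh h0 inth
  (fun n w => a n w - (A + e) * n%:R)).
- by move=> n; apply: measurable_funB.
- by move=> w; rewrite a0 mulr0 subr0.
- by move=> w; have := a1 w; have := A_ge0; lra.
- by move=> l n w; rewrite natrD; have := aD l n w; lra.
have e20 : 0 < e / 2 by rewrite divr_gt0.
(* The constant 1 in place of [K] excludes the time 0, since [a 0] vanishes. *)
apply: filterS (ae_low e20) => w /lowP /(_ (e / 2) 1 e20) [n].
case: n => [|n]; first by rewrite a0 mulr0; lra.
by move=> Hn; exists n; move: Hn; rewrite -addrA -splitr; lra.
Qed.

(** The upper bound is [ae_upper]. The lower one is the failure of [low c] for [c] below [A], which
    bounds [a n w] below by [c * n%:R] up to a constant, for all [n] at once. *)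
Lemma ergodic_drift : exists2 A : R, 0 <= A &
  {ae P, forall w, sublinear (fun n => `|a n w - A * n%:R|)}.
Proof.
exists A => //.
have up : {ae P, forall w, forall j : nat,
    sublinear (fun n => a n w - (A + j.+1%:R^-1) * n%:R)}.
  by apply: ae_foralln => j; exact: ae_upper.
have lo : {ae P, forall w, forall j : nat,
    0 <= A - j.+1%:R^-1 -> ~ low (A - j.+1%:R^-1) w}.
  apply: ae_foralln => j; have [c0|_] := boolP (0 <= A - j.+1%:R^-1).
    have := ae_not_low c0; rewrite gtrBl invr_gt0 ltr0n => /(_ isT).
    by apply: filterS => w nl _.
  exact: aeW.
apply: filterS2 up lo => w upw low_w.
apply: sublinear_norm => e e0.
  have e20 : 0 < e / 2 by rewrite divr_gt0.
  have [j hj] := invr_nat_le e20; have [K HK] := upw j _ e20.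
  exists K => n; have := HK n.
  have : j.+1%:R^-1 * n%:R <= e / 2 * n%:R by rewrite ler_wpM2r.
  by move: (j.+1%:R^-1) => q; lra.
have [j hj] := invr_nat_le e0.
have hj' (n : nat) : j.+1%:R^-1 * n%:R <= e * n%:R by rewrite ler_wpM2r.
(* When [A] is below the tolerance, the lower bound is just [a_ge0]. *)
have [c0|] := boolP (0 <= A - j.+1%:R^-1); last first.
  rewrite -ltNge => c0; exists 0 => n; have := a_ge0 n w.
  have : 0 <= (e - A) * n%:R.
    by rewrite mulr_ge0//; move: hj c0; move: (j.+1%:R^-1) => q; lra.
  lra.
have /lowP nlow := low_w j c0; apply: contrapT => nK; apply: nlow => e' K e'0.
apply: contrapT => nn; apply: nK; exists K => n.
have : (A - j.+1%:R^-1 + e') * n%:R < a n w + K.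
  by rewrite ltNge; apply/negP => le; apply: nn; exists n.
have := hj' n; have : 0 <= e' * n%:R by rewrite mulr_ge0// ltW.
by move: (j.+1%:R^-1) => q; lra.
Qed.

End Drift.

(** * Drift of the random walk *)

Section Walk.
Variable G : groupType.

(* [walk] applied to a path is otherwise elaborated in [discrete G]. *)
Local Notation walk := (@walk G).

Lemma walk0 (w : nat -> G) : walk w 0 = 1%g.
Proof. by rewrite /walk big_ord0. Qed.

Lemma walk1 (w : nat -> G) : walk w 1 = w 0%N.
Proof. by rewrite /walk big_ord1. Qed.

Lemma walkD (w : path_space G) l n :
  walk w (l + n) = (walk w l * walk (iter l (@path_shift G) w) n)%g.
Proof.
rewrite /walk big_split_ord/=; congr (_ * _)%g.
by apply: eq_bigr => i _; rewrite iter_path_shift.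
Qed.

Lemma walkS (w : path_space G) n :
  walk w n.+1 = ((w : nat -> G) 0%N * walk (path_shift w) n)%g.
Proof. by rewrite -add1n walkD walk1. Qed.

(** The event is split according to the countably many values of [u]. *)
Lemma measurable_mulg d (T : measurableType d) (u v : T -> discrete G) :
  countable [set: G] -> measurable_fun setT u -> measurable_fun setT v ->
  measurable_fun setT (fun t => (u t * v t)%g : discrete G).
Proof.
move=> cG mu mv _ A _; rewrite setTI.
rewrite (_ : _ @^-1` A = \bigcup_(g : G) (u @^-1` [set g : discrete G] `&`
    v @^-1` [set k : discrete G | A (g * k)%g])); last first.
  apply/seteqP; split => t /=; first by move=> At; exists (u t).
  by move=> [g _ [/= <-]].
apply: countable_bigcupT_measurable => // g; apply: measurableI.
  by rewrite -[X in measurable X]setTI; exact: mu.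
by rewrite -[X in measurable X]setTI; exact: mv.
Qed.

Lemma measurable_walk n : countable [set: G] ->
  measurable_fun setT (fun w : path_space G => walk w n : discrete G).
Proof.
move=> cG; elim: n => [|n ih].
  by rewrite (_ : (fun _ => _) = cst 1%g)//; apply/funext => w; rewrite walk0.
rewrite (_ : (fun _ => _) = fun w : path_space G =>
    (walk w n * (w : nat -> G) n)%g : discrete G); last first.
  by apply/funext => w; rewrite /walk big_ord_recr.
by apply: measurable_mulg => //; exact: measurable_coordinate.
Qed.

Context {R : realType} {X : metricType R}.
Variables (aX : G -> X -> X) (x : X).
Hypothesis aX_isometric : isometric_action aX.

Let aXM g k y : aX (g * k)%g y = aX g (aX k y).
Proof. exact: aX_isometric.1.2. Qed.

Let aX_dist g y z : mdist (aX g y) (aX g z) = mdist y z.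
Proof. exact: aX_isometric.2. Qed.

Definition displacement (n : nat) (w : path_space G) : R :=
  mdist x (aX (walk w n) x).

Lemma displacement0 w : displacement 0 w = 0.
Proof. by rewrite /displacement walk0 aX_isometric.1.1 mdistxx. Qed.

Lemma displacement1 w : displacement 1 w = mdist x (aX ((w : nat -> G) 0%N) x).
Proof. by rewrite /displacement walk1. Qed.

Lemma displacement_shift l n w :
  displacement n (iter l (@path_shift G) w) =
  mdist (aX (walk w l) x) (aX (walk w (l + n)) x).
Proof. by rewrite walkD aXM aX_dist. Qed.

Lemma displacementD l n w :
  displacement (l + n) w <=
  displacement l w + displacement n (iter l (@path_shift G) w).
Proof. by rewrite displacement_shift; exact: metric_triangle. Qed.

Lemma displacement_shift_le n w :
  displacement n (path_shift w) <= displacement 1 w + displacement n.+1 w.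
Proof.
rewrite (displacement_shift 1) add1n /displacement.
by rewrite [X in _ <= X + _]metric_sym; exact: metric_triangle.
Qed.

Lemma measurable_displacement n : countable [set: G] ->
  measurable_fun setT (displacement n).
Proof.
move=> cG; rewrite (_ : displacement n =
  (fun g : discrete G => mdist x (aX g x)) \o
  (fun w : path_space G => walk w n : discrete G))//.
apply: measurableT_comp; first exact: measurable_discrete.
exact: measurable_walk.
Qed.

Variables (mu : probability (discrete G) R) (P : probability (path_space G) R).
Hypothesis G_countable : countable [set: G].
Hypothesis P_product : is_product_measure mu P.
Hypothesis mu_moment : finite_first_moment aX mu.

Lemma integral_displacement1 : (\int[P]_w (displacement 1 w)%:E < +oo)%E.
Proof.
have [y inty] := mu_moment.
pose f (g : discrete G) := mdist x (aX g x).
rewrite (_ : (fun w => _) = (fun g => (f g)%:E) \o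
    (fun w : path_space G => (w : nat -> G) 0%N : discrete G)); last first.
  by apply/funext => w; rewrite displacement1.
rewrite -(@ge0_integral_pushforward _ _ _ _ _ _ (@measurable_coordinate G 0%N)
  P setT (fun g => (f g)%:E))//; last first.
  by move=> g _; rewrite lee_fin mdist_ge0.
rewrite (eq_measure_integral mu); last first.
  by move=> mf A mA AT; exact: (product_measure_marginal P_product).
  exact: measurable_coordinate.
(* The moment is finite at [y]; moving the base point to [x] costs at most twice [mdist x y]. *)
apply: (@le_lt_trans _ _
  (\int[mu]_g ((mdist x y + mdist x y)%:E + (mdist y (aX g y))%:E)%E)%E).
  apply: ge0_le_integral => //.
  - by move=> g _; rewrite lee_fin mdist_ge0.
  - move=> g _; rewrite -EFinD lee_fin /f.
    have := metric_triangle x y (aX g x).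
    have := metric_triangle y (aX g y) (aX g x).
    by rewrite aX_dist (metric_sym y x); lra.
rewrite ge0_integralD//; last 2 first.
- by move=> g _; rewrite lee_fin addr_ge0// mdist_ge0.
- by move=> g _; rewrite lee_fin mdist_ge0.
apply: lte_add_pinfty inty; rewrite integral_cst//.
rewrite [X in (_ * X)%E](_ : _ = 1%E) ?mule1 ?ltry//.
exact: probability_setT.
Qed.

Lemma ae_drift : exists2 A : R, 0 <= A &
  {ae P, forall w, sublinear (fun n => `|displacement n w - A * n%:R|)}.
Proof.
apply: (@ergodic_drift _ _ _ _ _ (path_shift_measure_preserving P_product)
  (path_shift_zero_one P_product) (displacement 1)) => //.
- exact: measurable_displacement.
- by move=> w; exact: mdist_ge0.
- exact: integral_displacement1.
- by move=> n; exact: measurable_displacement.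
- by move=> n w; exact: mdist_ge0.
- exact: displacement0.
- exact: displacementD.
- exact: displacement_shift_le.
Qed.

Lemma ae_sublinear_step : {ae P, forall w,
  sublinear (fun n => mdist (aX (walk w n) x) (aX (walk w n.+1) x))}.
Proof.
have := ae_sublinear_orbit (path_shift_measure_preserving P_product)
  (measurable_displacement 1 G_countable) (fun w => mdist_ge0 _ _)
  integral_displacement1.
apply: filterS => w; apply: sublinear_le => n.
by rewrite displacement_shift addn1.
Qed.

End Walk.

(** * Rays tracked by a line *)

Section Tracking.
Context {R : realType} {X : metricType R}.

Lemma dist_line_near (y : X) (c : R -> X) (e : R) : 0 < e ->
  exists t, mdist y (c t) < dist_line y c + e.
Proof.
move=> e0; have [||_ [t _ <-] lt] := @inf_adherent R
  [set mdist y (c t) | t in [set: R]] e; [by []| |by exists t].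
split; first by exists (mdist y (c 0)), 0.
by exists 0 => _ [t _ <-]; exact: mdist_ge0.
Qed.

(** Eventually [|t n|] is at least three quarters of [A * n%:R] while steps are at most one quarter
    of it, too short to cross 0. *)
Lemma eventually_constant_sign (t : nat -> R) (A : R) : 0 < A ->
  sublinear (fun n => `| `|t n| - A * n%:R|) ->
  sublinear (fun n => `|t n - t n.+1|) ->
  exists2 s : R, `|s| = 1 & \forall n \near \oo, t n = s * `|t n|.
Proof.
move=> A0 st ss; have A4 : 0 < A / 4 by rewrite divr_gt0.
have [N _ HN] : \forall n \near \oo, [/\ (0 < n)%N,
    `| `|t n| - A * n%:R| <= A / 4 * n%:R &
    `|t n - t n.+1| <= A / 4 * n%:R].
  near=> n; split; near: n; [exact: nbhs_infty_gt|exact: sublinear_near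
    |exact: sublinear_near].
have step n : (N <= n)%N -> (0 < t n) = (0 < t n.+1).
  move=> Nn; have [n0 h1 h2] := HN n Nn.
  have [_ h3 _] := HN n.+1 (leqW Nn).
  have An : 0 < A * n%:R by rewrite mulr_gt0// ltr0n.
  move: h1 h2 h3; rewrite -[n.+1%:R]natr1 !ler_norml.
  move=> /andP[h1 _] /andP[h2 h2'] /andP[h3 _].
  have [t0|t0] := ltP 0 (t n); have [t1|t1] := ltP 0 (t n.+1) => //; exfalso.
    by move: h1 h3; rewrite gtr0_norm// ler0_norm//; lra.
  by move: h1 h3; rewrite ler0_norm// gtr0_norm//; lra.
have sgn n : (N <= n)%N -> (0 < t n) = (0 < t N).
  move=> /subnKC <-; elim: (n - N)%N => [|k ih]; first by rewrite addn0.
  by rewrite addnS -step ?ih// leq_addr.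
exists (if 0 < t N then 1 else -1); first by case: ifP; rewrite ?normrN normr1.
exists N => // n /= Nn; rewrite -(sgn n Nn); case: ltP => t0.
  by rewrite gtr0_norm// mul1r.
by rewrite ler0_norm// mulrNN mul1r.
Unshelve. all: by end_near. Qed.

Lemma geodesic_line_ray (c : R -> X) (s : R) : geodesic_lines c -> `|s| = 1 ->
  geodesic_ray (fun r => c (s * r)).
Proof.
by move=> cl s1 r r' _ _; rewrite cl// -mulrBr normrM s1 mul1r.
Qed.

Lemma ray_of_tracked_line (p : nat -> X) (c : R -> X) (A : R) :
  geodesic_lines c -> 0 <= A ->
  sublinear (fun n => `|mdist (p 0%N) (p n) - A * n%:R|) ->
  sublinear (fun n => mdist (p n) (p n.+1)) ->
  sublinear (fun n => dist_line (p n) c) ->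
  exists2 r : R -> X, geodesic_ray r &
    mdist (p n) (r (A * n%:R)) / n%:R @[n --> \oo] --> (0 : R).
Proof.
move=> cl A0 sa sp sd.
have cray s : `|s| = 1 -> geodesic_ray (fun r => c (s * r)).
  exact: geodesic_line_ray.
pose D := mdist (p 0%N) (c 0).
(* The slack 1 allows a near-minimiser [t n] to be chosen without the infimum being attained. *)
pose r n := dist_line (p n) c + 1.
have sr : sublinear r by apply: sublinearD => //; exact: sublinear_cst.
have /choice[t ht] n : exists t, mdist (p n) (c t) <= r n.
  by have [t lt] := dist_line_near (p n) c ltr01; exists t; exact: ltW.
have normt n : mdist (c (t n)) (c 0) = `|t n| by rewrite cl// subr0.
pose q n := `|mdist (p 0%N) (p n) - A * n%:R| + (r n + D).
have sq : sublinear q.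
  by apply: sublinearD => //; apply: sublinearD => //; exact: sublinear_cst.
(* The distance from [c (t n)] to [c 0] is [|t n|]; it differs from the distance between [p n] and
   [p 0] by at most [r n + D]. *)
have tq n : `| `|t n| - A * n%:R| <= q n.
  have h1 := metric_triangle (c (t n)) (p n) (c 0).
  have h2 := metric_triangle (p n) (p 0%N) (c 0).
  have h3 := metric_triangle (p 0%N) (c 0) (p n).
  have h4 := metric_triangle (c 0) (c (t n)) (p n).
  have h5 := ht n; have h6 := ler_norm (mdist (p 0%N) (p n) - A * n%:R).
  have h7 := lerNnormlW (lexx `|mdist (p 0%N) (p n) - A * n%:R|).
  move: h1 h2 h3 h4 h5 h6 h7.
  rewrite (metric_sym (c (t n)) (p n)) (metric_sym (p n) (p 0%N)).
  rewrite (metric_sym (c 0) (c (t n))) normt -/D => *.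
  by rewrite ler_norml /q; apply/andP; split; lra.
have [A_eq0|A_gt0] := eqVneq A 0.
  (* For [A = 0] the sign of [t] may oscillate, but the ray is evaluated only at its origin, so
     either half of the line serves. *)
  exists (fun s => c (1 * s)); first by apply: cray; rewrite normr1.
  apply: (@sublinear_cvg _ _ (fun n => r n + q n)) => //.
  - by move=> n; exact: mdist_ge0.
  - near=> n; rewrite A_eq0 !mul0r mulr0.
    apply: (le_trans (metric_triangle _ (c (t n)) _)); rewrite normt.
    by apply: lerD => //; have := tq n; rewrite A_eq0 mul0r subr0 normr_id.
  - exact: sublinearD.
have {}A_gt0 : 0 < A by rewrite lt_def A_gt0.
have [||s s1 hs] := @eventually_constant_sign t A A_gt0.
- exact: sublinear_le tq sq.
- apply: (@sublinear_le _ _ (fun n => r n + (mdist (p n) (p n.+1) + r n.+1))).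
    move=> n; rewrite -cl//.
    apply: (le_trans (metric_triangle _ (p n) _)); apply: lerD.
      by rewrite metric_sym.
    by apply: (le_trans (metric_triangle _ (p n.+1) _)); rewrite lerD2l.
  apply: sublinearD => //; apply: sublinearD => //.
  exact: (sublinear_shift sr).
exists (fun r => c (s * r)); first exact: cray.
apply: (@sublinear_cvg _ _ (fun n => r n + q n)) => //.
- by move=> n; exact: mdist_ge0.
- near=> n; apply: (le_trans (metric_triangle _ (c (t n)) _)).
  apply: lerD => //; rewrite cl//.
  have -> : t n - s * (A * n%:R) = s * (`|t n| - A * n%:R).
    by rewrite mulrBr; congr (_ - _); near: n.
  by rewrite normrM s1 mul1r.
- exact: sublinearD.
Unshelve. all: by end_near. Qed.

End Tracking.

(** * Null sets and product measures *)

(** The base is indexed through an injection into [nat]; indices outside its image receive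
    [set0]. *)
Lemma second_countable_open_cover (T : topologicalType) :
  @second_countable T -> exists U : nat -> set T, (forall n, open (U n)) /\
    forall W, open W -> W = \bigcup_(n in [set n | U n `<=` W]) U n.
Proof.
move=> [B /countable_injP[f injf] [Bo Bb]].
have /choice[U HU] n : exists V, open V /\ (forall W, B W -> f W = n -> V = W).
  have [[V BV fV]|nV] := pselect (exists2 V, B V & f V = n).
    exists V; split; first exact: Bo.
    by move=> W BW fW; apply: injf; rewrite ?inE// fV fW.
  exists set0; split; first exact: open0.
  by move=> W BW fW; exfalso; apply: nV; exists W.
exists U; split=> [n|W oW]; first exact: (HU n).1.
apply/seteqP; split => [y Wy|y [n /= + Uy]]; last exact.
have [V [BV Vy] VW] := Bb y W (open_nbhs_nbhs (conj oW Wy)).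
by exists (f V) => /=; rewrite ((HU (f V)).2 V BV erefl).
Qed.

Section Negligible.
Context d (T : measurableType d) (R : realType).

Lemma eq_measure_setY (mu : {measure set T -> \bar R}) (A B : set T) :
  measurable A -> measurable B -> mu.-negligible (A `+` B) -> mu A = mu B.
Proof.
move=> mA mB; rewrite /setY => nAB.
have half (C D : set T) : measurable C -> measurable D ->
    mu.-negligible (C `\` D) -> mu C = mu (C `&` D).
  move=> mC mD n; rewrite (measureDI mu mC mD).
  by rewrite (measure_negligible _ n) ?add0e//; exact: measurableD.
rewrite (half A B)//; last by apply: negligibleS nAB; exact: subsetUl.
rewrite (half B A)//; first by rewrite setIC.
by apply: negligibleS nAB; exact: subsetUr.
Qed.

Lemma ae_ex (P : probability T R) (Q : T -> Prop) :
  {ae P, forall w, Q w} -> exists w, Q w.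
Proof.
move=> aeQ; apply: contrapT => nQ; suff : P setT = 0%E.
  by rewrite probability_setT => /eqP; rewrite onee_eq0.
apply: measure_negligible => //; apply: negligibleS aeQ => w _ /= Qw.
by apply: nQ; exists w.
Qed.

End Negligible.

Section ProductAE.
Context d1 d2 (T1 : measurableType d1) (T2 : measurableType d2) (R : realType).
Variables (P1 : probability T1 R) (P2 : probability T2 R).

Lemma ae_fst (A : T1 -> Prop) : {ae P1, forall w, A w} ->
  {ae (P1 \x P2)%E, forall u, A u.1}.
Proof.
move=> [N [mN N0 AN]]; exists (N `*` setT); split.
- exact: measurableX.
- rewrite product_measure1E//.
  exact: etrans (congr1 (fun z => (z * _)%E) N0) (mul0e _).
- by move=> u /= /AN.
Qed.

Lemma ae_snd (A : T2 -> Prop) : {ae P2, forall w, A w} ->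
  {ae (P1 \x P2)%E, forall u, A u.2}.
Proof.
move=> [N [mN N0 AN]]; exists (setT `*` N); split.
- exact: measurableX.
- rewrite product_measure1E//.
  exact: etrans (congr1 (fun z => (_ * z)%E) N0) (mule0 _).
- by move=> u /= /AN.
Qed.

(** Almost every section of the null set is null, whereas over a point where [A] fails the section
    is everything and has measure 1. *)
Lemma ae_product_fst (A : T1 -> Prop) :
  {ae (P1 \x P2)%E, forall u, A u.1} -> {ae P1, forall w, A w}.
Proof.
move=> [N [mN N0 AN]].
have mx : measurable_fun setT (fun w => P2 (xsection N w)).
  exact: measurable_fun_xsection.
have : ae_eq P1 setT (fun w => P2 (xsection N w)) (cst 0%E).
  apply/ae_eq_integral_abs => //; rewrite -[RHS]N0.
  by apply: eq_integral => w _; rewrite gee0_abs.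
apply: filterS => w /(_ Logic.I) /= Pw; apply: contrapT => nA.
have : xsection N w = setT.
  by apply/seteqP; split => // w' _; rewrite /xsection /= inE; exact: AN.
by move=> E; move: Pw; rewrite E probability_setT => /eqP; rewrite onee_eq0.
Qed.

Context d3 d4 (U1 : measurableType d3) (U2 : measurableType d4).
Variables (Q1 : probability U1 R) (Q2 : probability U2 R).
Variables (f1 : T1 -> U1) (f2 : T2 -> U2).
Hypotheses (mf1 : measurable_fun setT f1) (mf2 : measurable_fun setT f2).
Hypothesis Q1E : forall E, measurable E -> Q1 E = P1 (f1 @^-1` E).
Hypothesis Q2E : forall E, measurable E -> Q2 E = P2 (f2 @^-1` E).

(** On rectangles, the image of [P1 \x P2] under the pair of maps agrees with [Q1 \x Q2], so the two
    measures coincide. *)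
Lemma ae_product_comp (A : U1 * U2 -> Prop) :
  {ae (Q1 \x Q2)%E, forall p, A p} ->
  {ae (P1 \x P2)%E, forall u, A (f1 u.1, f2 u.2)}.
Proof.
move=> [N [mN N0 AN]].
pose f (u : T1 * T2) := (f1 u.1, f2 u.2).
have mf : measurable_fun setT f.
  apply: measurable_fun_pair.
    by apply: measurableT_comp => //; exact: measurable_fst.
  by apply: measurableT_comp => //; exact: measurable_snd.
exists (f @^-1` N); split.
- by rewrite -[X in measurable X]setTI; exact: mf.
- apply: etrans N0; apply/esym.
  apply: (@product_measure_unique _ _ _ _ _ Q1 Q2
    (pushforward (P1 \x P2)%E f)) => //.
  move=> A1 A2 mA1 mA2; apply: etrans (esym (congr2 mule (Q1E mA1) (Q2E mA2))).
  apply: product_measure1E.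
    by rewrite -[X in measurable X]setTI; exact: mf1.
  by rewrite -[X in measurable X]setTI; exact: mf2.
- by move=> u nA; exact: AN.
Qed.

End ProductAE.

(** * The boundary map *)

Section BoundaryMap.
Context {R : realType} {G : groupType} {X : metricType R}.
Variables (aX : G -> X -> X) (Xbar : ptopologicalType) (iota : X -> Xbar).
Variables (aXbar : G -> Xbar -> Xbar) (x : X).
Hypothesis aX_isometric : isometric_action aX.
Hypothesis Xbar_bordification : is_bordification aX iota aXbar.

Let hausdorff := bord_hausdorff Xbar_bordification.

Lemma measurable_boundary : measurable (boundary iota : set (borel Xbar)).
Proof.
apply: measurableC; apply: sub_sigma_algebra.
exact: (bord_open Xbar_bordification).
Qed.

Lemma converges_to_unique w z z' :
  converges_to aX iota x w z -> converges_to aX iota x w z' -> z = z'.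
Proof. by move=> cz cz'; exact: (cvg_unique hausdorff cz cz'). Qed.

(** Prefixing [g] multiplies all later positions by [g] on the left, and [aXbar g] is continuous. *)
Lemma converges_to_cons g (w : path_space G) z :
  converges_to aX iota x w z ->
  converges_to aX iota x (path_cons g w) (aXbar g z).
Proof.
move=> cz; rewrite /converges_to -cvg_shiftS/=.
rewrite (_ : (fun n => _) = fun n => aXbar g (iota (aX (@walk G w n) x))).
  have cg : {for z, continuous (aXbar g)}.
    exact: (bord_continuous Xbar_bordification).
  exact: (cvg_comp _ _ cz cg).
apply/funext => n; rewrite walkS (bord_extends Xbar_bordification).
by congr iota; exact: aX_isometric.1.2.
Qed.

Lemma converges_to_shift (w : path_space G) z :
  converges_to aX iota x w z ->
  converges_to aX iota x (path_shift w) (aXbar ((w : nat -> G) 0%N)^-1%g z).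
Proof.
move=> cz; set g := (w : nat -> G) 0%N.
rewrite /converges_to.
rewrite (_ : (fun n => _) =
    fun n => aXbar (g^-1)%g (iota (aX (@walk G w n.+1) x))).
  have cg : {for z, continuous (aXbar (g^-1)%g)}.
    exact: (bord_continuous Xbar_bordification).
  have cz' : iota (aX (@walk G w n.+1) x) @[n --> \oo] --> z.
    by rewrite (cvg_shiftS (fun n => iota (aX (@walk G w n) x))).
  exact: (cvg_comp _ _ cz' cg).
apply/funext => n; rewrite walkS (bord_extends Xbar_bordification).
by rewrite -aX_isometric.1.2 mulgA mulVg mul1g.
Qed.

Variables (P : probability (path_space G) R) (nu : probability (borel Xbar) R).
Hypothesis P_converges : {ae P, forall w,
  exists2 xi, boundary iota xi & converges_to aX iota x w xi}.
Hypothesis nu_hitting : is_hitting_measure aX iota x P nu.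

(* Off a null set, each basic open set has a measurable preimage under the limit
   map by [nu_hitting]; second countability makes one null set suffice. *)
Lemma measurable_boundary_map : exists f : path_space G -> borel Xbar,
  [/\ measurable_fun setT f, forall w, boundary iota (f w),
      {ae P, forall w, converges_to aX iota x w (f w)} &
      forall E, measurable E -> nu E = P (f @^-1` E)].
Proof.
have [w0 [z0 bz0 _]] := ae_ex P_converges.
have [U [oU coverU]] :=
  second_countable_open_cover (bord_second_countable Xbar_bordification).
have mU n : measurable (U n : set (borel Xbar)) by exact: sub_sigma_algebra.
have /choice[A HA] n := nu_hitting (mU n).
have nAU : P.-negligible (\bigcup_n (A n `+` hits aX iota x (U n))).
  by apply: negligible_bigcup => n; have [] := HA n.
have [N [mN N0 subN]] := negligibleU nAU P_converges.
have convN w : ~ N w ->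
    exists2 xi, boundary iota xi & converges_to aX iota x w xi.
  by move=> nN; apply: contrapT => nc; apply: nN; apply: subN; right.
pose lim0 w := xget z0
  [set xi | boundary iota xi /\ converges_to aX iota x w xi].
have lim0P w : ~ N w ->
    boundary iota (lim0 w) /\ converges_to aX iota x w (lim0 w).
  move=> /convN[z bz cz].
  apply: (xgetPex z0 (P :=
    [set xi | boundary iota xi /\ converges_to aX iota x w xi])).
  by exists z.
(* The constant [z0] on the null set keeps [f] measurable and boundary-valued everywhere. *)
pose f w : borel Xbar := if `[< N w >] then z0 else lim0 w.
have fN w : N w -> f w = z0 by move=> Nw; rewrite /f asboolT.
have fnN w : ~ N w -> f w = lim0 w by move=> Nw; rewrite /f asboolF.
have hitsE E w : ~ N w -> hits aX iota x E w <-> E (f w).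
  move=> nN; have [b c] := lim0P w nN; rewrite fnN//; split.
    by move=> [z [_ Ez cz]]; rewrite (converges_to_unique c cz).
  by move=> Ez; exists (lim0 w).
have mfU n : measurable (f @^-1` U n).
  (* Off [N], lying in [A n], hitting [U n] and having [f w] in [U n] are the same event. *)
  have -> : f @^-1` U n = (A n `\` N) `|` (N `&` [set _ | U n z0]).
    apply/seteqP; split => w /=.
      have [Nw|nN] := pselect (N w); first by rewrite fN//; right.
      move=> Uw; left; split => //; apply: contrapT => nA; apply: (nN).
      by apply: subN; left; exists n => //; right; split => //; exact/hitsE.
    move=> [[Aw nN]|[Nw Uz]]; last by rewrite fN.
    apply/hitsE => //; apply: contrapT => nh; apply: (nN); apply: subN; left.
    by exists n => //; left.
  apply: measurableU; first by apply: measurableD => //; have [] := HA n.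
  have [Uz|nUz] := pselect (U n z0).
    by rewrite (_ : [set _ | _] = setT) ?setIT//; apply/seteqP; split.
  by rewrite (_ : [set _ | _] = set0) ?setI0//; apply/seteqP; split.
have mf : measurable_fun setT f.
  apply: (@measurability _ _ (path_space G) (borel Xbar) setT f
    (@open Xbar) erefl).
  move=> _ [V oV <-]; rewrite setTI (coverU V oV) preimage_bigcup.
  exact: bigcup_measurable.
exists f; split => //.
- move=> w; have [Nw|nN] := pselect (N w); first by rewrite fN.
  by rewrite fnN//; have [] := lim0P w nN.
- exists N; split => // w /= nc; apply: contrapT => nN; apply: nc.
  by rewrite fnN//; have [] := lim0P w nN.
move=> E mE; have [B [mB nB ->]] := nu_hitting mE.
apply: eq_measure_setY => //.
  by rewrite -[X in measurable X]setTI; exact: mf.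
have nN : P.-negligible N by exact/negligibleP.
apply: negligibleS (negligibleU nB nN) => w.
have [Nw|nNw] := pselect (N w); first by move=> _; right.
by move=> h; left; move: h; rewrite /setY/=; have := hitsE E w nNw; tauto.
Qed.

End BoundaryMap.

(** * Deviation from the lines *)

Section DistLine.
Context {R : realType} {G : groupType} {X : metricType R}.
Implicit Types (c : R -> X) (y z : X).

Let dist_set y c := [set mdist y (c t) | t in [set: R]].

Let has_inf_dist y c : has_inf (dist_set y c).
Proof.
split; first by exists (mdist y (c 0)), 0.
by exists 0 => _ [t _ <-]; exact: mdist_ge0.
Qed.

Lemma dist_line_ge0 y c : 0 <= dist_line y c.
Proof.
apply: lb_le_inf; first exact: (has_inf_dist y c).1.
by move=> _ [t _ <-]; exact: mdist_ge0.
Qed.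

Lemma dist_line_triangle y z c : dist_line y c <= mdist y z + dist_line z c.
Proof.
rewrite -lerBlDl; apply: lb_le_inf; first exact: (has_inf_dist z c).1.
move=> _ [t _ <-]; rewrite lerBlDl; apply: le_trans (metric_triangle y z _).
by apply: ge_inf; [exact: (has_inf_dist y c).2|exists t].
Qed.

Variable aX : G -> X -> X.
Hypothesis aX_isometric : isometric_action aX.

Lemma dist_line_action g y c :
  dist_line y (fun t => aX g (c t)) = dist_line (aX (g^-1)%g y) c.
Proof.
have [[a1 aM] ad] := aX_isometric.
rewrite /dist_line; congr inf; apply: eq_imagel => t _.
by rewrite -(ad (g^-1)%g) -aM mulVg a1.
Qed.

Variables (Xbar : ptopologicalType) (iota : X -> Xbar).
Variables (aXbar : G -> Xbar -> Xbar) (x : X).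
Variable L : Xbar -> Xbar -> set (R -> X).
Hypothesis L_equivariant : forall g eta xi, boundary iota eta ->
  boundary iota xi -> L (aXbar g eta) (aXbar g xi) =
    [set (fun t => aX g (c t)) | c in L eta xi].

Lemma sup_dist_ge0 p : (0 <= sup_dist x L p)%E.
Proof.
rewrite /sup_dist; case: ifPn => // /set0P[c Lc].
apply: (@le_trans _ _ (dist_line x c)%:E).
  by rewrite lee_fin dist_line_ge0.
by apply: ereal_sup_ubound; exists c.
Qed.

Lemma dist_line_le_sup_dist p c : L p.1 p.2 c ->
  ((dist_line x c)%:E <= sup_dist x L p)%E.
Proof.
move=> Lc; rewrite /sup_dist; case: ifPn => _; first exact: leey.
by apply: ereal_sup_ubound; exists c.
Qed.

(** Each line of the translated pair is a translate of some [c], and its distance to [x] is that of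
    [c] to the inverse translate of [x]. Without lines the right-hand side is infinite. *)
Lemma sup_dist_action g eta xi : boundary iota eta -> boundary iota xi ->
  (sup_dist x L (aXbar g eta, aXbar g xi) <=
   sup_dist x L (eta, xi) + (mdist x (aX (g^-1)%g x))%:E)%E.
Proof.
move=> be bx; rewrite {2}/sup_dist/=; case: ifPn => [_|/set0P[c0 Lc0]].
  by rewrite addye ?leey.
rewrite /sup_dist/= L_equivariant// ifF; last first.
  by apply/negbTE/set0P; exists (fun t => aX g (c0 t)); exists c0.
apply: ge_ereal_sup => _ [_ [c Lc <-] <-].
rewrite dist_line_action.
apply: (@le_trans _ _ ((dist_line x c)%:E + (mdist x (aX (g^-1)%g x))%:E)%E).
  rewrite -EFinD lee_fin addrC metric_sym; exact: dist_line_triangle.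
by apply: leeD2r; apply: ereal_sup_ubound; exists c.
Qed.

End DistLine.

(** * Sublinear distance from the walk to a line *)

Section Deviation.
Context {R : realType} {G : groupType} {X : metricType R}.
Variables (aX : G -> X -> X) (Xbar : ptopologicalType) (iota : X -> Xbar).
Variables (aXbar : G -> Xbar -> Xbar) (x : X).
Hypothesis aX_isometric : isometric_action aX.
Hypothesis Xbar_bordification : is_bordification aX iota aXbar.
Variables (m : set (discrete G) -> \bar R).
Variables (P Pc : probability (path_space G) R).
Hypothesis Pm : is_product_measure m P.
Hypothesis Pcm : is_product_measure (reflected m) Pc.
Hypothesis G_countable : countable [set: G].
Hypothesis moment : (\int[P]_w (displacement aX x 1 w)%:E < +oo)%E.
Variables (xi eta : path_space G -> borel Xbar).
Hypotheses (mxi : measurable_fun setT xi) (meta : measurable_fun setT eta).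
Hypotheses (bxi : forall w, boundary iota (xi w)).
Hypotheses (beta : forall w, boundary iota (eta w)).
Hypothesis cxi : {ae P, forall w, converges_to aX iota x w (xi w)}.
Hypothesis ceta : {ae Pc, forall w, converges_to aX iota x w (eta w)}.
Variable L : Xbar -> Xbar -> set (R -> X).
Hypothesis L_lines : forall e z, boundary iota e -> boundary iota z ->
  L e z `<=` geodesic_lines.
Hypothesis L_equivariant : forall g e z, boundary iota e ->
  boundary iota z -> L (aXbar g e) (aXbar g z) =
    [set (fun t => aX g (c t)) | c in L e z].
Hypothesis mL : measurable_fun
  (boundary iota `*` boundary iota : set (borel Xbar * borel Xbar))
  (sup_dist x L).

Local Notation path := (path_space G).
Local Notation Q := (P \x Pc)%E.

Hypothesis finL : {ae Q, forall u, (sup_dist x L (xi u.1, eta u.2) < +oo)%E}.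

(** The maps [xi] and [eta] are true limits only off a null set, so their equivariance along an
    orbit can be used only at generic points. *)
Let generic (u : path * path) : Prop :=
  [/\ converges_to aX iota x u.1 (xi u.1),
      converges_to aX iota x u.2 (eta u.2) &
      (sup_dist x L (xi u.1, eta u.2) < +oo)%E].

Let ae_generic :
  {ae Q, forall u, forall n, generic (iter n (@bishift G) u)}.
Proof.
apply: (ae_iter (bishift_measure_preserving Pm Pcm)).
by apply: filterS3 (ae_fst Pc cxi) (ae_snd P ceta) finL => u.
Qed.

(** The shift drops the first increment of the forward path and prefixes its inverse to the backward
    one. Both limits are thus translated by the same element, and limits are unique. *)
Let generic_bishift u : generic u -> generic (bishift u) ->
  let g := ((u.1 : nat -> G) 0%N)^-1%g in
  xi (bishift u).1 = aXbar g (xi u.1) /\ eta (bishift u).2 = aXbar g (eta u.2).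
Proof.
move=> [c1 c2 _] [d1 d2 _] g; split.
  apply: (converges_to_unique Xbar_bordification d1).
  exact: (converges_to_shift aX_isometric Xbar_bordification).
apply: (converges_to_unique Xbar_bordification d2).
exact: (converges_to_cons aX_isometric Xbar_bordification).
Qed.

Let f (u : path * path) : R := fine (sup_dist x L (xi u.1, eta u.2)).

Let measurable_f : measurable_fun setT f.
Proof.
apply: measurableT_comp; first exact: fine_measurable.
apply: (measurable_comp _ _ mL).
- by apply: measurableX; exact: (measurable_boundary Xbar_bordification).
- by move=> _ [u _ <-]; split; [exact: bxi|exact: beta].
apply: measurable_fun_pair.
  by apply: measurableT_comp => //; exact: measurable_fst.
by apply: measurableT_comp => //; exact: measurable_snd.
Qed.

Let f_fin u : generic u -> (f u)%:E = sup_dist x L (xi u.1, eta u.2).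
Proof. by move=> [_ _ fu]; rewrite fineK// ge0_fin_numE// sup_dist_ge0. Qed.

Let integral_step : (\int[Q]_u (displacement aX x 1 u.1)%:E < +oo)%E.
Proof.
have mfst : measurable_fun setT (fst : path * path -> path).
  exact: measurable_fst.
have mh : measurable_fun setT (EFin \o displacement aX x 1).
  apply/measurable_EFinP; exact: measurable_displacement.
rewrite -(@ge0_integral_pushforward _ _ _ _ _ _ mfst Q setT
  (EFin \o displacement aX x 1))//; last first.
  by move=> w _; rewrite lee_fin mdist_ge0.
rewrite (eq_measure_integral P)// => A mA _.
rewrite /= /pushforward (_ : _ @^-1` _ = A `*` setT); last first.
  by apply/seteqP; split => u //=; tauto.
apply: etrans (product_measure1E _ _ mA measurableT) _.
by apply: etrans (congr1 (fun z => (_ * z)%E) (probability_setT Pc)) (mule1 _).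
Qed.

Let ae_sublinear_f :
  {ae Q, forall u, sublinear (fun n => f (iter n (@bishift G) u))}.
Proof.
apply: (@ae_sublinear_iter _ _ _ _ _ (bishift_measure_preserving Pm Pcm)
  (fun u => displacement aX x 1 u.1)) => //.
- apply: measurableT_comp; last exact: measurable_fst.
  exact: measurable_displacement.
- by move=> u; exact: mdist_ge0.
- by move=> u; rewrite fine_ge0// sup_dist_ge0.
apply: filterS ae_generic => u gu.
have g0 := gu 0%N; have g1 := gu 1%N.
rewrite -lee_fin EFinD !f_fin//.
have [-> ->] := generic_bishift g0 g1.
have := sup_dist_action aX_isometric x L_equivariant
  ((u.1 : nat -> G) 0%N)^-1%g (@bxi u.1) (@beta u.2).
by rewrite invgK displacement1.
Qed.

Let boundary_orbit u n : (forall k, generic (iter k (@bishift G) u)) ->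
  let g := ((@walk G u.1 n)^-1)%g in
  xi (iter n (@bishift G) u).1 = aXbar g (xi u.1) /\
  eta (iter n (@bishift G) u).2 = aXbar g (eta u.2).
Proof.
have [a1 aM] := bord_action Xbar_bordification.
move=> gu; elim: n => [|n [ih1 ih2]] g.
  by rewrite /g walk0 invg1 !a1.
have [] := generic_bishift (gu n) (gu n.+1); rewrite ih1 ih2 -!aM.
rewrite iter_bishift1 iter_path_shift addn0 -invgM.
by rewrite /g /walk big_ord_recr.
Qed.

(** By equivariance, [f] along the orbit bounds the distance from [x] to the line moved by the
    inverse of [walk], which is the distance from the walk to the line. The backward path only
    supplies the second boundary point and is removed by [ae_product_fst]. *)
Lemma ae_tracked_line : {ae P, forall w, exists2 c, geodesic_lines c &
  sublinear (fun n => dist_line (aX (@walk G w n) x) c)}.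
Proof.
apply: (@ae_product_fst _ _ _ _ _ P Pc).
apply: filterS2 ae_generic ae_sublinear_f => u gu sf.
(* The value [+oo] given to an empty set of lines turns finiteness into existence. *)
have [c Lc] : exists c, L (xi u.1) (eta u.2) c.
  have [_ _] := gu 0%N; rewrite /= /sup_dist/=.
  by case: ifPn => [_|/set0P//]; rewrite ltxx.
exists c; first exact: (L_lines (@bxi _) (@beta _) Lc).
apply: sublinear_le sf => n; rewrite -lee_fin f_fin//.
have [-> ->] := boundary_orbit n gu.
pose g := ((@walk G u.1 n)^-1)%g.
apply: (@le_trans _ _ (dist_line x (fun t => aX g (c t)))%:E).
  by rewrite (dist_line_action aX_isometric) invgK.
by apply: dist_line_le_sup_dist; rewrite /= L_equivariant//; exists c.
Qed.

End Deviation.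

(** * Existence of the tracking ray *)

Theorem theorem6 (R : realType) (G : groupType) (X : metricType R)
    (aX : G -> X -> X) (Xbar : ptopologicalType) (iota : X -> Xbar)
    (aXbar : G -> Xbar -> Xbar) (x : X)
    (mu : probability (discrete G) R)
    (P Pcheck : probability (path_space G) R)
    (nu nucheck : probability (borel Xbar) R)
    (G_countable : countable [set: G])
    (X_geodesic : geodesic_space X)
    (aX_isometric : isometric_action aX)
    (Xbar_bordification : is_bordification aX iota aXbar)
    (mu_moment : finite_first_moment aX mu)
    (P_product : is_product_measure mu P)
    (Pcheck_product : is_product_measure (reflected mu) Pcheck)
    (P_converges : {ae P, forall w,
       exists2 xi, boundary iota xi & converges_to aX iota x w xi})
    (Pcheck_converges : {ae Pcheck, forall w,
       exists2 eta, boundary iota eta & converges_to aX iota x w eta})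
    (nu_hitting : is_hitting_measure aX iota x P nu)
    (nucheck_hitting : is_hitting_measure aX iota x Pcheck nucheck)
    (lines : exists L : Xbar -> Xbar -> set (R -> X),
      [/\ forall eta xi, boundary iota eta -> boundary iota xi ->
            L eta xi `<=` geodesic_lines,
          forall g eta xi, boundary iota eta -> boundary iota xi ->
            L (aXbar g eta) (aXbar g xi) =
            [set (fun t => aX g (c t)) | c in L eta xi],
          measurable_fun
            (boundary iota `*` boundary iota : set (borel Xbar * borel Xbar))
            (sup_dist x L) &
          {ae (nu \x nucheck)%E, forall p,
            boundary iota p.1 -> boundary iota p.2 ->
            (sup_dist x L p < +oo)%E}]) :
  exists2 A : R, 0 <= A &
    {ae P, forall w, exists2 c : R -> X, geodesic_ray c &
      mdist (aX (walk w n) x) (c (A * n%:R)) / n%:R @[n --> \oo] --> (0 : R)}.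
Proof.
have [L [L_lines L_equivariant mL finL]] := lines.
have [xi [mxi bxi cxi nuE]] :=
  measurable_boundary_map Xbar_bordification P_converges nu_hitting.
have [eta [meta beta ceta nucheckE]] :=
  measurable_boundary_map Xbar_bordification Pcheck_converges nucheck_hitting.
(* The limit maps carry the path measures to [nu] and [nucheck], so finiteness passes from pairs of
   boundary points to pairs of paths. *)
have finxi : {ae (P \x Pcheck)%E, forall u,
    (sup_dist x L (xi u.1, eta u.2) < +oo)%E}.
  apply: filterS (ae_product_comp mxi meta nuE nucheckE finL) => u.
  by apply; [exact: bxi|exact: beta].
have moment := integral_displacement1 x aX_isometric P_product mu_moment.
have tracked := ae_tracked_line aX_isometric Xbar_bordification P_product
  Pcheck_product G_countable moment mxi meta bxi beta cxi ceta L_lines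
  L_equivariant mL finxi.
have step := ae_sublinear_step x aX_isometric G_countable P_product mu_moment.
have [A A0 drift] := ae_drift x aX_isometric G_countable P_product mu_moment.
have FP : Filter (almost_everywhere P) by exact: ae_filter_ringOfSetsType.
exists A => //.
(* From here on the argument is deterministic, for one sample path at a time. *)
apply: (@filterS3 _ _ FP _ _ _ _ _ tracked drift step) => w [c cl sd] sa sp.
apply: (@ray_of_tracked_line _ _ (fun n => aX (@walk G w n) x) c A) => //.
by rewrite walk0 aX_isometric.1.1.
Qed.
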